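(* Let $n$ be a positive integer and let $\Lambda$ be a basic Artin algebra. Then $\Lambda$ is a minimal $n$-Auslander-Gorenstein algebra if and only if $$\mathrm{GP}^{\le n}(\Lambda)=\{N\in\Lambda\text{-mod}\mid \mathrm{Gpd}(\mathrm{soc}\,N)\le n\}=\mathrm{sub}\,\Lambda .$$
   Context: All modules are finitely generated left modules; $\Lambda\text{-mod}$ is the category of finitely generated left $\Lambda$-modules. For a minimal injective coresolution $0\to\Lambda\to I_0\to I_1\to\cdots$ of the left regular module, the dominant dimension $\mathrm{domdim}\,\Lambda$ is the supremum of the integers $d\ge 0$ such that $I_j$ is projective for all $0\le j<d$. An Artin algebra $\Lambda$ is a minimal $n$-Auslander-Gorenstein algebra if $\mathrm{id}\,{}_\Lambda\Lambda\le n+1\le\mathrm{domdim}\,\Lambda$, where $\mathrm{id}$ is injective dimension. $\mathrm{soc}$ denotes the socle. $\mathrm{Gpd}$ denotes the Gorenstein projective dimension: a module is Gorenstein projective if it is a syzygy (image of a differential) of an exact complex of finitely generated projective modules that stays exact after applying $\mathrm{Hom}_\Lambda(-,\Lambda)$, and $\mathrm{Gpd}\,N$ is the minimal length of a resolution of $N$ by Gorenstein projective modules ($\infty$ if no finite one exists); the zero module is regarded as having $\mathrm{Gpd}\le n$. $\mathrm{GP}^{\le n}(\Lambda)$ is the full subcategory of $\Lambda$-modules $N$ with $\mathrm{Gpd}\,N\le n$. $\mathrm{sub}\,\Lambda$ is the full subcategory of $\Lambda$-modules cogenerated by a finite direct sum of copies of $\Lambda$, i.e. isomorphic to a submodule of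 $\Lambda^k$ for some $k\geq 0$. *)

(* Defs.v *)
From HB Require Import structures.
From mathcomp Require Import all_boot all_algebra.
From mathcomp Require Import boolp.

Set Implicit Arguments.
Unset Strict Implicit.
Unset Printing Implicit Defensive.

Import GRing.Theory.
Local Open Scope ring_scope.

(* Submodules of M are terms of type [submodClosed M].  Their membership      *)
(* predicates are boolean, but by classical logic this is no restriction: any *)
(* P : M -> Prop is the boolean predicate fun x => `[< P x >].                *)

Definition submod (R : pzRingType) (M : lmodType R) (U : submodClosed M) : Type :=
  {x : M | x \in U}.

HB.instance Definition _ (R : pzRingType) (M : lmodType R) (U : submodClosed M) :=
  [isSub of submod U for @sval M (fun x => x \in U)].
HB.instance Definition _ (R : pzRingType) (M : lmodType R) (U : submodClosed M) :=
  [Choice of submod U by <:].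
HB.instance Definition _ (R : pzRingType) (M : lmodType R) (U : submodClosed M) :=
  [SubChoice_isSubLmodule of submod U by <:].

Section Modules.
Variable R : pzRingType.
Implicit Types M N : lmodType R.

Definition zero_mod M : Prop := forall x : M, x = 0.

Definition isomorphic M N : Prop := exists f : {linear M -> N}, bijective f.

Definition surjective (A B : Type) (f : A -> B) : Prop :=
  forall y, exists x, f x = y.

Definition exact (A B C : lmodType R) (f : A -> B) (g : B -> C) : Prop :=
  forall y, g y = 0 <-> exists x, f x = y.

Definition finitely_generated M : Prop :=
  exists (m : nat) (g : 'I_m -> M),
    forall x, exists c : 'I_m -> R, x = \sum_i c i *: g i.

Definition artinian M : Prop :=
  forall U : nat -> submodClosed M,
    (forall i, {subset U i.+1 <= U i}) ->
    exists m, forall i, (m <= i)%N -> U i =i U m.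

Definition simple_mod M : Prop :=
  ~ zero_mod M /\
  forall V : submodClosed M, (forall x, x \in V -> x = 0) \/ (forall x, x \in V).

Definition indecomposable M : Prop :=
  ~ zero_mod M /\
  forall V W : submodClosed M,
    (forall x, exists v w, [/\ v \in V, w \in W & x = v + w]) ->
    (forall x, x \in V -> x \in W -> x = 0) ->
    (forall x, x \in V -> x = 0) \/ (forall x, x \in W -> x = 0).

Definition internal_direct_sum M (m : nat) (U : 'I_m -> submodClosed M) : Prop :=
  forall x, exists! u : {ffun 'I_m -> M},
    (forall i, u i \in U i) /\ x = \sum_i u i.

(* The sum of all simple submodules. *)
Definition socle M : {pred M} := fun x =>
  `[< exists (m : nat) (S : 'I_m -> submodClosed M) (s : 'I_m -> M),
        [/\ forall i, simple_mod (submod (S i)),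
            forall i, s i \in S i & x = \sum_i s i] >].

Lemma socle_submod_closed M : submod_closed (@socle M).
Proof.
split.
  apply/asboolP; exists 0, (fun i : 'I_0 => match i with Ordinal _ h =>
    False_rect _ (notF h) end), (fun=> 0); split; try by case.
  by rewrite big_ord0.
move=> a x y /asboolP[m [S [s [sS sin ->]]]] /asboolP[p [T [t [sT tin ->]]]].
apply/asboolP; exists (m + p)%N,
  (fun i => match split i with inl j => S j | inr j => T j end),
  (fun i => match split i with inl j => a *: s j | inr j => t j end).
split=> [i|i|]; try by case: (split i) => j //; rewrite rpredZ.
rewrite big_split_ord /= scaler_sumr; congr (_ + _); apply: eq_bigr => i _.
  by case: split_ordP => j /= => [/lshift_inj -> //|/eqP]; rewrite eq_lrshift.
by case: split_ordP => j /= => [/eqP|/rshift_inj -> //]; rewrite eq_rlshift.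
Qed.

HB.instance Definition _ M :=
  GRing.isSubmodClosed.Build R M (@socle M) (@socle_submod_closed M).

Definition soc M : lmodType R := submod (@socle M : submodClosed M).

(* The image of f is an essential submodule of N. *)
Definition essential M N (f : M -> N) : Prop :=
  forall V : submodClosed N,
    (forall x, f x \in V -> f x = 0) -> forall y, y \in V -> y = 0.

(* Projectives and injectives are those of the category of finitely generated *)
(* modules.                                                                   *)
Definition projective_mod (P : lmodType R) : Prop :=
  finitely_generated P /\
  forall (M N : lmodType R) (f : {linear M -> N}) (g : {linear P -> N}),
    finitely_generated M -> finitely_generated N -> surjective f ->
    exists h : {linear P -> M}, forall x, f (h x) = g x.

Definition injective_mod (I : lmodType R) : Prop :=
  finitely_generated I /\
  forall (M N : lmodType R) (f : {linear M -> N}) (g : {linear M -> I}),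
    finitely_generated M -> finitely_generated N -> injective f ->
    exists h : {linear N -> I}, forall x, h (f x) = g x.

Record injective_coresolution M := InjectiveCoresolution {
  cores_term : nat -> lmodType R;
  cores_aug : {linear M -> cores_term 0};
  cores_diff : forall j, {linear cores_term j -> cores_term j.+1};
  cores_injective : forall j, injective_mod (cores_term j);
  cores_aug_inj : injective cores_aug;
  cores_exact0 : exact cores_aug (cores_diff 0);
  cores_exact : forall j, exact (cores_diff j) (cores_diff j.+1) }.

Definition minimal_coresolution M (C : injective_coresolution M) : Prop :=
  essential (cores_aug C) /\ forall j, essential (cores_diff C j).

(* id M <= n *)
Definition injdim_le M (n : nat) : Prop :=
  exists (C : injective_coresolution M) (l : nat),
    (l <= n)%N /\ forall j, (l < j)%N -> zero_mod (cores_term C j).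

(* n <= domdim R *)
Definition domdim_ge (n : nat) : Prop :=
  exists2 C : injective_coresolution R^o, minimal_coresolution C &
  exists2 d : nat, (n <= d)%N &
    forall j, (j < d)%N -> projective_mod (cores_term C j).

(* Differentials go from degree i to degree 1 + i; the second exactness       *)
(* condition is that of the complex Hom(P, R).                                *)
Definition totally_acyclic (P : int -> lmodType R)
    (d : forall i, {linear P i -> P (1 + i)}) : Prop :=
  [/\ forall i, projective_mod (P i),
      forall i, exact (d i) (d (1 + i)) &
      forall i (f : {linear P (1 + i) -> R^o}),
        (forall x, f (d i x) = 0) <->
        exists g : {linear P (1 + (1 + i)) -> R^o},
          forall x, g (d (1 + i) x) = f x].

Definition gorenstein_projective M : Prop :=
  exists (P : int -> lmodType R) (d : forall i, {linear P i -> P (1 + i)}),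
    totally_acyclic d /\
    exists (i : int) (e : {linear M -> P (1 + i)}),
      injective e /\ forall y, (exists x, e x = y) <-> (exists z, d i z = y).

Definition gp_resolution M (l : nat) (G : nat -> lmodType R)
    (d : forall j, {linear G j.+1 -> G j}) (eps : {linear G 0 -> M}) : Prop :=
  [/\ forall j, (j <= l)%N -> gorenstein_projective (G j),
      forall j, (l < j)%N -> zero_mod (G j),
      surjective eps, exact (d 0) eps & forall j, exact (d j.+1) (d j)].

(* Gpd M <= n *)
Definition Gpd_le M (n : nat) : Prop :=
  exists2 l : nat, (l <= n)%N &
  exists (G : nat -> lmodType R) (d : forall j, {linear G j.+1 -> G j})
    (eps : {linear G 0 -> M}), gp_resolution l d eps.

Definition cogenerated_by_regular M : Prop :=
  exists (k : nat) (f : {linear M -> 'rV[R]_k}), injective f.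

End Modules.

(* L is an algebra over k through a ring morphism into its center, rather     *)
(* than an [algType k], because the latter excludes the zero algebra.         *)
Definition artin_algebra (L : pzRingType) : Prop :=
  exists (k : comPzRingType) (phi : {rmorphism k -> L}),
    [/\ artinian k^o,
        forall a x, phi a * x = x * phi a &
        exists (m : nat) (g : 'I_m -> L),
          forall x, exists c : 'I_m -> k, x = \sum_i phi (c i) * g i].

Definition basic (L : pzRingType) : Prop :=
  exists (m : nat) (P : 'I_m -> submodClosed L^o),
    [/\ internal_direct_sum P,
        forall i, indecomposable (submod (P i)) &
        forall i j, isomorphic (submod (P i)) (submod (P j)) -> i = j].

Definition minimal_auslander_gorenstein (n : nat) (L : pzRingType) : Prop :=
  injdim_le L^o n.+1 /\ domdim_ge L n.+1.

(* The subcategories below are given by their classes of objects. *)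

Definition GP_le (L : pzRingType) (n : nat) (N : lmodType L) : Prop :=
  finitely_generated N /\ Gpd_le N n.

Definition socGP_le (L : pzRingType) (n : nat) (N : lmodType L) : Prop :=
  finitely_generated N /\ Gpd_le (soc N) n.

Definition sub_regular (L : pzRingType) (N : lmodType L) : Prop :=
  finitely_generated N /\ cogenerated_by_regular N.

(* Main.v *)
From HB Require Import structures.
Require Import Defs.
From mathcomp Require Import all_boot all_algebra.
From mathcomp Require Import generic_quotient ring_quotient boolp classical_sets.

Set Implicit Arguments.
Unset Strict Implicit.
Unset Printing Implicit Defensive.

Import GRing.Theory.
Local Open Scope ring_scope.

(* Write C_0 = L and C_{j+1} for the cokernel of C_j in the j-th term of an   *)
(* injective coresolution of L, and call X torsion if Hom(X, L) = 0.          *)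
(*                                                                            *)
(* Assume that the three subcategories agree.  Then a simple submodule S of L *)
(* has an injective hull J: finitely generated essential extensions of S lie  *)
(* in sub L by the socle condition, hence embed in L, and so have bounded     *)
(* length.  J is then a summand of L.  Hence every module in sub L has a      *)
(* projective injective hull.  Since C_j has Gpd at most j, it lies in sub L  *)
(* for j <= n, so the first n + 1 terms of the minimal coresolution are       *)
(* projective; C_{n+1} is injective because every module has Gpd at most n +  *)
(* 1.                                                                         *)
(*                                                                            *)
(* For a minimal n-Auslander-Gorenstein algebra, a module is in sub L iff it  *)
(* receives no nonzero map from a torsion module, and vanishing of Ext^i(X,-) *)
(* for torsion X passes along Gorenstein projective resolutions, so that      *)
(* Gpd N <= n implies that N is in sub L.  For the other inclusion one shows  *)
(* that (n+1)-st syzygies have cosyzygies of the same kind.  This uses that   *)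
(* every torsion simple module embeds in C_{n+1}, which is a count: modulo    *)
(* maps through projective injectives, End(L) = End(C_{n+1}), so each         *)
(* indecomposable projective that is not injective contributes a torsion      *)
(* simple submodule of C_{n+1}, each injective one contributes its socle, and *)
(* these simple modules are pairwise non-isomorphic, hence exhaust all        *)
(* simple modules since there are as many as indecomposable projectives.      *)

(** * Submodules, quotients and exact sequences *)

(** Ext is used only through its vanishing, phrased as extension and lifting properties
    ([ext1_zero], [ext_zero]), and finite length only through a strictly increasing rank on
    submodules ([ranked]).

    From the subcategories to the coresolution: the socle condition keeps finitely generated
    essential extensions of simples of [sub L] inside [sub L], and the length of [L] bounds them, so
    these simples embed in projective-injective modules ([simple_proj_inj_hull]). Hence every module
    of [sub L] has an essential embedding into a projective-injective one
    ([sub_essential_proj_inj]). [gp_dim_coresolved] then climbs the coresolution: C_j has Gpd at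
    most j, and Ext^1(X, C_j) = 0 whenever Gpd X is at most j. At j = n + 1 this covers every X.

    From the coresolution to the subcategories: [sub L] is the torsion-free class of a hereditary
    torsion theory ([tors_sub], [torsion_part], [sub_of_tors_free]). Vanishing of Ext from torsion
    modules costs one degree per step of a Gorenstein projective resolution, so one degree survives
    n steps ([GP_le_sub]). In the other direction ([sub_GP_le]), a syzygy is Gorenstein projective
    once its left approximation by free modules has a cokernel of the same kind. The missing degree
    for that cokernel comes from [domdim_mod1_of_ext1], which needs every torsion simple inside
    C_{n+1}; this is the counting lemma [simple_tors_embeds]. Finally [sub_soc] transfers membership
    in [sub L] between a module and its socle. *)

Section Constructions.
Variable R : pzRingType.
Implicit Types A B C K M N P Q X Y : lmodType R.

(** Submodules are plain predicates here, so that images, kernels and sums need no packaging;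
    [submodClosed_of] converts where the definitions ask for a [submodClosed]. *)
Definition is_submod M (U : M -> Prop) : Prop :=
  U 0 /\ forall a x y, U x -> U y -> U (a *: x + y).

Lemma is_submodD M (U : M -> Prop) x y : is_submod U -> U x -> U y -> U (x + y).
Proof. by case=> _ UD Ux Uy; rewrite -[x]scale1r; apply: UD. Qed.

Lemma is_submodZ M (U : M -> Prop) a x : is_submod U -> U x -> U (a *: x).
Proof. by case=> U0 UD Ux; rewrite -[_ *: _]addr0; apply: UD. Qed.

Lemma is_submodN M (U : M -> Prop) x : is_submod U -> U x -> U (- x).
Proof. by move=> Us Ux; rewrite -scaleN1r; apply: is_submodZ. Qed.

Lemma is_submodB M (U : M -> Prop) x y : is_submod U -> U x -> U y -> U (x - y).
Proof. by move=> Us Ux Uy; apply: is_submodD => //; apply: is_submodN. Qed.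

Lemma is_submod_sum M (U : M -> Prop) (I : Type) (r : seq I) (P : pred I) (F : I -> M) :
  is_submod U -> (forall i, P i -> U (F i)) -> U (\sum_(i <- r | P i) F i).
Proof.
by move=> Us UF; elim/big_ind: _ => //; [case: Us|move=> *; apply: is_submodD].
Qed.

Lemma is_submod_mem M (V : submodClosed M) : is_submod (fun x => x \in V).
Proof. by split=> [|a x y Vx Vy]; rewrite ?rpred0 // rpredD // rpredZ. Qed.

Lemma submodClosed_of M (U : M -> Prop) : is_submod U ->
  exists V : submodClosed M, forall x, x \in V <-> U x.
Proof.
move=> [U0 UD]; pose P : {pred M} := fun x => `[< U x >].
have clP : submod_closed P.
  by split=> [|a x y /asboolP Ux /asboolP Uy]; apply/asboolP => //; apply: UD.
pose A := GRing.isSubmodClosed.Build R M P clP.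
pose V : submodClosed M := HB.pack P A.
by exists V => x; rewrite -[_ \in V]/(P x); split=> /asboolP.
Qed.

Lemma linear_of M N (f : M -> N) : (forall a x y, f (a *: x + y) = a *: f x + f y) ->
  exists g : {linear M -> N}, forall x, g x = f x.
Proof.
move=> fl; pose A := GRing.isLinear.Build R M N *:%R f fl.
pose g : {linear M -> N} := HB.pack f A.
by exists g.
Qed.

Lemma submodule_exists M (U : M -> Prop) : is_submod U ->
  exists (K : lmodType R) (i : {linear K -> M}),
    injective i /\ forall y, U y <-> exists x, i x = y.
Proof.
move=> /submodClosed_of[V VU].
exists (submod V), (\val : {linear submod V -> M}); split; first exact: val_inj.
move=> y; split=> [/VU Vy | [x <-]]; last by apply/VU; exact: valP.
by exists (exist _ y Vy).
Qed.

(** The quotient of additive groups, with scalars acting through chosen representatives; this is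
    well defined because [U] is stable under scaling. *)
Lemma quotient_exists M (U : M -> Prop) : is_submod U ->
  exists (Q : lmodType R) (p : {linear M -> Q}),
    surjective p /\ forall y, p y = 0 <-> U y.
Proof.
move=> Us; pose V : {pred M} := fun x => `[< U x >].
have VU x : x \in V <-> U x by split=> /asboolP.
have VZ a x : x \in V -> a *: x \in V by move=> /VU Ux; apply/VU; apply: is_submodZ.
have Vcl : zmod_closed V.
  by split=> [|x y /VU Ux /VU Uy]; apply/VU; [case: Us | apply: is_submodB].
pose B := GRing.isZmodClosed.Build M V Vcl.
pose I : zmodClosed M := HB.pack V B.
pose Q := Quotient.quot I.
pose sc (a : R) (u : Q) : Q := \pi_Q%qT (a *: repr u).
have piE (x y : M) : (\pi_Q%qT x = \pi_Q%qT y :> Q) <-> (x - y \in V).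
  rewrite -[x - y \in V]/(x - y \in I).
  by rewrite Quotient.idealrBE; split=> [->|/eqP].
have piD (x y : M) : \pi_Q%qT (x + y) = (\pi_Q%qT x + \pi_Q%qT y : Q).
  exact: Quotient.pi_add.
have scE a x : sc a (\pi_Q%qT x) = \pi_Q%qT (a *: x).
  by apply/piE; rewrite -scalerBr VZ //; apply/piE; rewrite reprK.
clearbody sc.
have A1 a b u : sc a (sc b u) = sc (a * b) u.
  by rewrite -[u]reprK !scE scalerA.
have A2 : left_id 1 sc by move=> u; rewrite -[u]reprK !scE scale1r.
have A3 : right_distributive sc +%R.
  by move=> a u v; rewrite -[u]reprK -[v]reprK -!piD !scE -piD scalerDr.
have A4 u : {morph (fun a => sc a u) : a b / a + b}.
  by move=> a b /=; rewrite -[u]reprK !scE -piD scalerDl.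
pose A := GRing.Zmodule_isLmodule.Build R Q A1 A2 A3 A4.
pose Q' : lmodType R := HB.pack Q A.
have pl a (x y : M) : (\pi_Q%qT (a *: x + y) : Q') = a *: (\pi_Q%qT x : Q') + \pi_Q%qT y.
  by rewrite [LHS]piD -scE.
have [p pE] := linear_of pl.
exists Q', p; split=> [u | y].
  by exists (repr (u : Q)); rewrite pE; apply: reprK.
rewrite -(linear0 p) !pE -VU -[X in X \in V]subr0.
exact: piE.
Qed.

Lemma factor_surj X B N (p : {linear X -> B}) (g : {linear X -> N}) :
  surjective p -> (forall x, p x = 0 -> g x = 0) ->
  exists h : {linear B -> N}, forall x, h (p x) = g x.
Proof.
move=> p_surj pg; have [s sE] := choice p_surj.
have gp x y : p x = p y -> g x = g y.
  by move=> e; apply/eqP; rewrite -subr_eq0 -linearB pg // linearB e subrr.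
have [|h hE] := @linear_of B N (fun b => g (s b)).
  by move=> a x y; rewrite -linearP; apply: gp; rewrite linearP !sE.
by exists h => x; rewrite hE; apply: gp; rewrite sE.
Qed.

Lemma factor_inj X A M (i : {linear A -> M}) (g : {linear X -> M}) :
  injective i -> (forall x, exists a, i a = g x) ->
  exists h : {linear X -> A}, forall x, i (h x) = g x.
Proof.
move=> i_inj /choice[s sE].
have [|h hE] := @linear_of X A s.
  by move=> a x y; apply: i_inj; rewrite linearP !sE linearP.
by exists h => x; rewrite hE sE.
Qed.

Lemma linear_inj M N (f : {linear M -> N}) :
  (forall x, f x = 0 -> x = 0) -> injective f.
Proof.
by move=> f0 x y e; apply/eqP; rewrite -subr_eq0; apply/eqP/f0; rewrite linearB e subrr.
Qed.

Lemma is_submod_ker M N (f : {linear M -> N}) : is_submod (fun x => f x = 0).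
Proof. by split=> [|a x y fx fy]; rewrite ?linear0 // linearP fx fy scaler0 addr0. Qed.

Lemma is_submod_im M N (f : {linear M -> N}) (U : M -> Prop) :
  is_submod U -> is_submod (fun y => exists2 x, U x & f x = y).
Proof.
move=> [U0 UD]; split; first by exists 0; rewrite ?linear0.
by move=> a _ _ [x Ux <-] [y Uy <-]; exists (a *: x + y); rewrite ?linearP //; apply: UD.
Qed.

Lemma is_submod_preim M N (f : {linear M -> N}) (V : N -> Prop) :
  is_submod V -> is_submod (fun x => V (f x)).
Proof. by move=> [V0 VD]; split=> [|a x y Vx Vy]; rewrite ?linear0 // linearP; apply: VD. Qed.

Lemma is_submodI M (U V : M -> Prop) :
  is_submod U -> is_submod V -> is_submod (fun x => U x /\ V x).
Proof. by move=> [U0 UD] [V0 VD]; split=> // a x y [? ?] [? ?]; split; [apply: UD | apply: VD]. Qed.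

Lemma is_submodS M (U V : M -> Prop) : is_submod U -> is_submod V ->
  is_submod (fun x => exists u v, [/\ U u, V v & x = u + v]).
Proof.
move=> [U0 UD] [V0 VD]; split; first by exists 0, 0; rewrite addr0.
move=> a _ _ [u [v [Uu Vv ->]]] [u' [v' [Uu' Vv' ->]]].
exists (a *: u + u'), (a *: v + v'); split; [exact: UD|exact: VD|].
by rewrite scalerDr addrACA.
Qed.

Lemma is_submod1 M (x : M) : is_submod (fun y => exists a : R, y = a *: x).
Proof.
split; first by exists 0; rewrite scale0r.
by move=> a _ _ [b ->] [c ->]; exists (a * b + c); rewrite scalerDl scalerA.
Qed.

Lemma is_submod0 M : is_submod (fun x : M => x = 0).
Proof. by split=> // a x y -> ->; rewrite scaler0 addr0. Qed.

Lemma is_submodT M : is_submod (fun _ : M => True).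
Proof. by []. Qed.

Definition ses A B C (i : A -> B) (p : B -> C) : Prop :=
  [/\ injective i, surjective p & @exact R A B C i p].

Lemma ses_ker M N (p : {linear M -> N}) : surjective p ->
  exists (K : lmodType R) (i : {linear K -> M}), ses i p.
Proof.
move=> p_surj; have [K [i [i_inj iK]]] := submodule_exists (is_submod_ker p).
by exists K, i.
Qed.

Lemma ses_coker M N (i : {linear M -> N}) : injective i ->
  exists (Q : lmodType R) (p : {linear N -> Q}), ses i p.
Proof.
move=> i_inj.
have [Q [p [p_surj pK]]] := quotient_exists (is_submod_im i (is_submodT M)).
exists Q, p; split=> // y; rewrite pK; split; first by case=> x; exists x.
by case=> x; exists x.
Qed.

Lemma ses0 A B C (i : {linear A -> B}) (p : {linear B -> C}) :
  ses i p -> forall x, p (i x) = 0.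
Proof. by case=> _ _ ex x; apply/ex; exists x. Qed.

Lemma ses_lift A B C X (i : {linear A -> B}) (p : {linear B -> C})
    (g : {linear X -> B}) :
  ses i p -> (forall x, p (g x) = 0) ->
  exists h : {linear X -> A}, forall x, i (h x) = g x.
Proof. by move=> [i_inj _ ex] g0; apply: factor_inj => // x; apply/ex. Qed.

Lemma ses_desc A B C X (i : {linear A -> B}) (p : {linear B -> C})
    (g : {linear B -> X}) :
  ses i p -> (forall x, g (i x) = 0) ->
  exists h : {linear C -> X}, forall x, h (p x) = g x.
Proof.
by move=> [_ p_surj ex] g0; apply: factor_surj => // x /ex[a <-]; apply: g0.
Qed.

End Constructions.

(** * Finitely generated modules and Ext *)

Section FinitelyGenerated.
Variable R : pzRingType.
Implicit Types A B C E I K M N P Q W X Y : lmodType R.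

Lemma linear_from_row M m (g : 'I_m -> M) :
  exists phi : {linear 'rV[R]_m -> M}, forall v, phi v = \sum_i v 0 i *: g i.
Proof.
apply: linear_of => a x y; rewrite scaler_sumr -big_split; apply: eq_bigr => i _ /=.
by rewrite !mxE scalerDl scalerA.
Qed.

Lemma linear_to_row M m (f : 'I_m -> {linear M -> R^o}) :
  exists F : {linear M -> 'rV[R]_m}, forall x i, F x 0 i = f i x.
Proof.
have [|F FE] := @linear_of R M 'rV[R]_m (fun x => \row_i f i x).
  by move=> a x y; apply/rowP => i; rewrite !mxE linearP.
by exists F => x i; rewrite FE mxE.
Qed.

Lemma linear_coord m (i : 'I_m) :
  exists f : {linear 'rV[R]_m -> R^o}, forall v, f v = v 0 i.
Proof. by apply: linear_of => a x y; rewrite !mxE. Qed.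

Lemma finitely_generatedP M : finitely_generated M <->
  exists m (phi : {linear 'rV[R]_m -> M}), surjective phi.
Proof.
split=> [[m [g gM]] | [m [phi phi_surj]]].
  have [phi phiE] := linear_from_row g; exists m, phi => y.
  have [c ->] := gM y; exists (\row_i c i); rewrite phiE.
  by apply: eq_bigr => i _; rewrite mxE.
exists m, (fun i => phi (delta_mx 0 i)) => x; have [v <-] := phi_surj x.
exists (fun i => v 0 i); rewrite {1}[v]row_sum_delta linear_sum.
by apply: eq_bigr => i _; rewrite linearZ.
Qed.

Lemma fg_surj M N (p : {linear M -> N}) :
  surjective p -> finitely_generated M -> finitely_generated N.
Proof.
move=> p_surj /finitely_generatedP[m [phi phi_surj]]; apply/finitely_generatedP.
exists m, (p \o phi) => y; have [x <-] := p_surj y; have [v <-] := phi_surj x.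
by exists v.
Qed.

Lemma fg_row m : finitely_generated 'rV[R]_m.
Proof. by apply/finitely_generatedP; exists m, idfun => x; exists x. Qed.

Lemma fg_prod M N : finitely_generated M -> finitely_generated N ->
  finitely_generated (M * N)%type.
Proof.
move=> [m [g gM]] [n [h hN]]; exists (m + n)%N.
exists (fun i => match split i with inl j => (g j, 0) | inr j => (0, h j) end).
move=> [x y]; have [c ->] := gM x; have [d ->] := hN y.
exists (fun i => match split i with inl j => c j | inr j => d j end).
rewrite big_split_ord /=.
have El i : split (lshift n i) = inl i :> 'I_m + 'I_n by exact: (unsplitK (inl i)).
have Er i : split (rshift m i) = inr i :> 'I_m + 'I_n by exact: (unsplitK (inr i)).
under [X in _ = X + _]eq_bigr do rewrite El.
under [X in _ = _ + X]eq_bigr do rewrite Er.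
apply/pair_equal_spec; split.
  rewrite -[LHS]addr0; congr (_ + _).
    by rewrite (linear_sum (fst : {linear (M * N)%type -> M})).
  by rewrite (linear_sum (fst : {linear (M * N)%type -> M})) big1 // => i _; rewrite /= scaler0.
rewrite -[LHS]add0r; congr (_ + _).
  by rewrite (linear_sum (snd : {linear (M * N)%type -> N})) big1 // => i _; rewrite /= scaler0.
by rewrite (linear_sum (snd : {linear (M * N)%type -> N})).
Qed.

Lemma linear_pair X M N (f : {linear X -> M}) (g : {linear X -> N}) :
  exists h : {linear X -> (M * N)%type}, forall x, h x = (f x, g x).
Proof. by apply: linear_of => a x y; rewrite !linearP. Qed.

Lemma linear_copair X M N (f : {linear M -> X}) (g : {linear N -> X}) :
  exists h : {linear (M * N)%type -> X}, forall u, h u = f u.1 + g u.2.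
Proof. by apply: linear_of => a x y /=; rewrite !linearP scalerDr addrACA. Qed.

Lemma projective_row m : projective_mod 'rV[R]_m.
Proof.
split; first exact: fg_row.
move=> M N f g _ _ f_surj.
have [s sE] := choice (fun i : 'I_m => f_surj (g (delta_mx 0 i))).
have [h hE] := linear_from_row s; exists h => v.
rewrite hE linear_sum {2}[v]row_sum_delta linear_sum.
by apply: eq_bigr => i _; rewrite !linearZ /= sE.
Qed.

Lemma projective_retract P Q (i : {linear P -> Q}) (r : {linear Q -> P}) :
  (forall x, r (i x) = x) -> projective_mod Q -> projective_mod P.
Proof.
move=> ri [fQ Qlift]; split.
  by apply: (@fg_surj _ _ r) => // y; exists (i y).
move=> M N f g fM fN f_surj.
have [h hE] := Qlift M N f (g \o r) fM fN f_surj.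
by exists (h \o i) => x /=; rewrite hE /= ri.
Qed.

Lemma injective_retract P Q (i : {linear P -> Q}) (r : {linear Q -> P}) :
  (forall x, r (i x) = x) -> injective_mod Q -> injective_mod P.
Proof.
move=> ri [fQ Qext]; split.
  by apply: (@fg_surj _ _ r) => // y; exists (i y).
move=> M N f g fM fN f_inj.
have [h hE] := Qext M N f (i \o g) fM fN f_inj.
by exists (r \o h) => x /=; rewrite hE /= ri.
Qed.

Lemma projective_prod P Q : projective_mod P -> projective_mod Q ->
  projective_mod (P * Q)%type.
Proof.
move=> [fP Pl] [fQ Ql]; split; first exact: fg_prod.
move=> M N f g fM fN f_surj.
have [i1 i1E] := linear_pair (idfun : {linear P -> P}) (\0 : {linear P -> Q}).
have [i2 i2E] := linear_pair (\0 : {linear Q -> P}) (idfun : {linear Q -> Q}).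
have [h1 h1E] := Pl M N f (g \o i1) fM fN f_surj.
have [h2 h2E] := Ql M N f (g \o i2) fM fN f_surj.
have [h hE] := linear_copair h1 h2; exists h => -[x y].
rewrite hE linearD h1E h2E /= i1E i2E -linearD; congr (g (_, _)) => /=.
  by rewrite addr0.
by rewrite add0r.
Qed.

Lemma injective_prod P Q : injective_mod P -> injective_mod Q ->
  injective_mod (P * Q)%type.
Proof.
move=> [fP Pl] [fQ Ql]; split; first exact: fg_prod.
move=> M N f g fM fN f_inj.
have [h1 h1E] := Pl M N f (fst \o g) fM fN f_inj.
have [h2 h2E] := Ql M N f (snd \o g) fM fN f_inj.
have [h hE] := linear_pair h1 h2; exists h => x.
by rewrite hE h1E h2E /=; case: (g x).
Qed.

Lemma fg_zero M : zero_mod M -> finitely_generated M.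
Proof. by move=> M0; exists 0, (fun=> 0) => x; exists (fun=> 0); rewrite big_ord0. Qed.

Lemma projective_zero M : zero_mod M -> projective_mod M.
Proof.
move=> M0; split; first exact: fg_zero.
by move=> X N f g _ _ _; exists \0 => x; rewrite [x]M0 !linear0.
Qed.

Lemma injective_zero M : zero_mod M -> injective_mod M.
Proof.
move=> M0; split; first exact: fg_zero.
by move=> X N f g _ _ _; exists \0 => x; rewrite [RHS]M0.
Qed.

Lemma zero_row0 : zero_mod 'rV[R]_0.
Proof. by move=> x; apply/rowP => -[]. Qed.

Lemma projective_summand_row P : projective_mod P ->
  exists m (i : {linear P -> 'rV[R]_m}) (r : {linear 'rV[R]_m -> P}),
    forall x, r (i x) = x.
Proof.
move=> [fP Pl]; have [m [phi phi_surj]] := (finitely_generatedP P).1 fP.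
have [i iE] := Pl _ _ phi idfun (fg_row m) fP phi_surj.
by exists m, i, phi.
Qed.

Lemma projective_torsionless P : projective_mod P -> cogenerated_by_regular P.
Proof.
move=> /projective_summand_row[m [i [r ri]]]; exists m, i.
exact: can_inj ri.
Qed.

Lemma torsionless_sub M N (i : {linear M -> N}) :
  injective i -> cogenerated_by_regular N -> cogenerated_by_regular M.
Proof. by move=> i_inj [k [f f_inj]]; exists k, (f \o i); apply: inj_comp. Qed.

Definition proj_inj E : Prop := projective_mod E /\ injective_mod E.

(** Projectivity, injectivity and [ext1_zero] test finitely generated modules only, so kernels and
    pullbacks must stay among them. *)
Definition noetherian_mods : Prop :=
  forall M N (i : {linear M -> N}),
    injective i -> finitely_generated N -> finitely_generated M.

End FinitelyGenerated.

Section Ext.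
Variable R : pzRingType.
Hypothesis noeth : noetherian_mods R.
Implicit Types A B C E I K M N P Q W X Y : lmodType R.

(** Ext^1(X, N) = 0: maps into [N] extend along every short exact sequence ending in [X] with
    finitely generated middle term. By [ext1_zero_of_presentation] one projective presentation
    suffices. *)
Definition ext1_zero X N : Prop :=
  forall A B (i : {linear A -> B}) (p : {linear B -> X}),
    finitely_generated B -> ses i p ->
    forall g : {linear A -> N}, exists h : {linear B -> N}, forall a, h (i a) = g a.

Lemma free_cover X : finitely_generated X ->
  exists m K (i : {linear K -> 'rV[R]_m}) (p : {linear 'rV[R]_m -> X}), ses i p.
Proof.
move=> /finitely_generatedP[m [p p_surj]].
by have [K [i ip]] := ses_ker p_surj; exists m, K, i, p.
Qed.

Lemma ses_fgl A B C (i : {linear A -> B}) (p : {linear B -> C}) :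
  ses i p -> finitely_generated B -> finitely_generated A.
Proof. by case=> i_inj _ _; apply: noeth i_inj. Qed.

Lemma ses_fgr A B C (i : {linear A -> B}) (p : {linear B -> C}) :
  ses i p -> finitely_generated B -> finitely_generated C.
Proof. by case=> _ p_surj _; apply: fg_surj p_surj. Qed.

(** Lifting [P -> X] to [B] presents [B] as the quotient of [A * P] by a copy of [K]; a map given on
    [A] and on [P] descends to [B] when it kills that copy. *)
Lemma ext1_zero_of_presentation K P X N (j : {linear K -> P}) (q : {linear P -> X}) :
  projective_mod P -> ses j q ->
  (forall f : {linear K -> N}, exists h : {linear P -> N}, forall k, h (j k) = f k) ->
  ext1_zero X N.
Proof.
move=> [fP Pl] jq Kext A B i p fB ip g.
have fX := ses_fgr ip fB.
have [u uE] := Pl B X p q fB fX (let: And3 _ h _ := ip in h).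
have [u' u'E] : exists h : {linear K -> A}, forall x, i (h x) = (u \o j) x.
  by apply: (ses_lift ip) => x /=; rewrite uE (ses0 jq).
have [v vE] := Kext (g \o u').
have [phi phiE] := linear_copair i u.
have [psi psiE] := linear_copair g v.
case: (ip) => i_inj p_surj pK; case: jq => j_inj q_surj qK.
have [||h hE] := @factor_surj R _ _ _ phi psi.
- move=> b; have [x xE] := q_surj (p b).
  have [|a aE] := (pK (b - u x)).1; first by rewrite linearB uE xE subrr.
  by exists (a, x); rewrite phiE /= aE subrK.
- move=> [a x]; rewrite phiE psiE /= => e.
  have [|k kE] := (qK x).1.
    by rewrite -uE -[u x](addKr (i a)) e addr0 linearN (ses0 ip) oppr0.
  have -> : a = - u' k.
    apply: i_inj; rewrite linearN u'E /= kE; apply/eqP.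
    by rewrite -subr_eq0 opprK e.
  by rewrite -kE vE linearN addNr.
exists h => a; have := hE (a, 0); rewrite phiE psiE /= !linear0 !addr0.
by [].
Qed.

Lemma ext1_zero_proj P N : projective_mod P -> ext1_zero P N.
Proof.
move=> Pp; have [fP Pl] := Pp.
apply: (@ext1_zero_of_presentation 'rV[R]_0 P P N \0 idfun) => //.
  split; first by move=> x y _; rewrite [x]zero_row0 [y]zero_row0.
    by move=> y; exists y.
  by move=> y; split=> [/= ->|[x <-]] //; exists 0.
by move=> f; exists \0 => k; rewrite [k]zero_row0 !linear0.
Qed.

Lemma ext1_zero_inj X N : injective_mod N -> ext1_zero X N.
Proof.
move=> [fN Next] A B i p fB ip g; case: (ip) => i_inj _ _.
by apply: Next => //; apply: noeth i_inj fB.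
Qed.

Lemma injective_of_ext1 N : finitely_generated N ->
  (forall X, finitely_generated X -> ext1_zero X N) -> injective_mod N.
Proof.
move=> fN Xext; split=> // A B f g fA fB f_inj.
have [Q [p fp]] := ses_coker f_inj.
exact: Xext (ses_fgr fp fB) _ _ _ _ fB fp g.
Qed.

Lemma pullback_exists M N X (f : {linear M -> X}) (g : {linear N -> X}) :
  exists W (p : {linear W -> M}) (q : {linear W -> N}),
  [/\ forall w, f (p w) = g (q w),
      finitely_generated M -> finitely_generated N -> finitely_generated W,
      forall m n, f m = g n -> exists w, p w = m /\ q w = n
    & forall w, p w = 0 -> q w = 0 -> w = 0].
Proof.
have Us : is_submod (fun u : (M * N)%type => f u.1 = g u.2).
  split=> [|a x y]; first by rewrite !linear0.
  by move=> e e'; rewrite !linearP /= e e'.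
have [W [e [e_inj eE]]] := submodule_exists Us.
exists W, (fst \o e), (snd \o e); split.
- by move=> w /=; apply/eE; exists w.
- by move=> fM fN; apply: noeth e_inj (fg_prod fM fN).
- by move=> m n /(eE (m, n)).1[w wE]; exists w; rewrite /= wE.
move=> w /= w1 w2; apply: e_inj; rewrite linear0.
by move: w1 w2; case: (e w) => /= _ _ -> ->.
Qed.

(** The pullback enters through its defining properties, so that the lemma applies to either of its
    two projections. *)
Lemma pullback_ses A B C X W (i : {linear A -> B}) (p : {linear B -> C})
    (f : {linear X -> C}) (h : {linear W -> B}) (q : {linear W -> X}) :
  ses i p ->
  [/\ forall w, p (h w) = f (q w),
      forall b x, p b = f x -> exists w, h w = b /\ q w = x
    & forall w, h w = 0 -> q w = 0 -> w = 0] ->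
  exists j : {linear A -> W}, ses j q /\ forall a, h (j a) = i a.
Proof.
move=> ip [hq Wp W0]; case: (ip) => i_inj p_surj pK.
have [j jE] : exists j : {linear A -> W}, forall a, h (j a) = i a /\ q (j a) = 0.
  have /choice[s sE] a : exists w, h w = i a /\ q w = 0.
    by apply: Wp; rewrite (ses0 ip) linear0.
  have [|j jE] := @linear_of R A W s.
    move=> a x y; apply/eqP; rewrite -subr_eq0; apply/eqP/W0.
      by rewrite linearB linearP !(fun z => (sE z).1) linearP subrr.
    by rewrite linearB linearP !(fun z => (sE z).2) scaler0 addr0 subrr.
  by exists j => a; rewrite !jE.
exists j; split; last by move=> a; case: (jE a).
split.
- by apply: linear_inj => a ja; apply: i_inj; rewrite linear0 -(jE a).1 ja linear0.
- move=> x; have [b bE] := p_surj (f x); have [w [_ <-]] := Wp _ _ bE.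
  by exists w.
move=> w; split=> [qw|[a <-]]; last by case: (jE a).
have [|a aE] := (pK (h w)).1; first by rewrite hq qw linear0.
exists a; apply/eqP; rewrite -subr_eq0; apply/eqP/W0.
  by rewrite linearB (jE a).1 aE subrr.
by rewrite linearB (jE a).2 qw subrr.
Qed.

Lemma ext1_zero_lift A B C X (i : {linear A -> B}) (p : {linear B -> C})
    (f : {linear X -> C}) :
  ses i p -> finitely_generated B -> finitely_generated X -> ext1_zero X A ->
  exists g : {linear X -> B}, forall x, p (g x) = f x.
Proof.
move=> ip fB fX XA; have [W [h [q [hq fgW Wp W0]]]] := pullback_exists p f.
have [j [jq hj]] := pullback_ses ip (And3 hq Wp W0).
have [r rE] := XA _ _ _ _ (fgW fB fX) jq idfun.
have [|g gE] := @ses_desc R _ _ _ _ j q (h \- (i \o r)) jq.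
  by move=> a /=; rewrite hj rE subrr.
exists g => x; case: jq => _ q_surj _; have [w <-] := q_surj x.
by rewrite gE /= linearB hq (ses0 ip) subr0.
Qed.

Lemma ext1_zero_of_lift A B C X (i : {linear A -> B}) (p : {linear B -> C}) :
  ses i p -> injective_mod B ->
  (forall f : {linear X -> C}, exists g : {linear X -> B}, forall x, p (g x) = f x) ->
  ext1_zero X A.
Proof.
move=> ip [fB Bext] Xlift A' B' i' p' fB' ip' g.
have [||h hE] := Bext _ _ i' (i \o g) _ fB'; first exact: ses_fgl ip' fB'.
  by case: ip'.
have [|c cE] := @ses_desc R _ _ _ _ i' p' (p \o h) ip'.
  by move=> a /=; rewrite hE (ses0 ip).
have [s sE] := Xlift c.
have [|k kE] := @ses_lift R _ _ _ _ i p (h \- (s \o p')) ip.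
  by move=> x /=; rewrite linearB sE cE subrr.
exists k => a; case: ip => i_inj _ _; apply: i_inj.
by rewrite kE /= hE (ses0 ip') linear0 subr0.
Qed.

(** Ext^1(K, N) = 0 lets maps K -> N' lift to [E], and injectivity extends the lifts to [B]. So
    Hom(B, N') -> Hom(K, N') is onto, Ext^1(M, N') embeds in Ext^1(B, N'), and the latter is 0. *)
Lemma ext1_zero_shift K B M N E N' (j : {linear K -> B}) (q : {linear B -> M})
    (i : {linear N -> E}) (p : {linear E -> N'}) :
  ses j q -> ses i p -> finitely_generated B -> injective_mod E ->
  ext1_zero K N -> ext1_zero B N' -> ext1_zero M N'.
Proof.
move=> jq ip fB [fE Eext] KN BN' A W a w fW aw g.
have fK := ses_fgl jq fB; have fA := ses_fgl aw fW.
have [V [pW [pB [pWB fgV Vp V0]]]] := pullback_exists w q.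
have fV := fgV fW fB.
have [al [alB pWal]] := pullback_ses aw (And3 pWB Vp V0).
have [be [beW pBbe]] : exists j' : {linear K -> V}, ses j' pW /\ forall k, pB (j' k) = j k.
  apply: (pullback_ses (f := w) jq); split=> [v|b x e|v v1 v2]; first by rewrite pWB.
    by have [v [? ?]] := Vp x b (esym e); exists v.
  exact: V0.
(* [g] extends to the pullback [V] of [W] and [B] over [M]. Subtracting a map through [E] makes the
   extension vanish on [K] and descend to [W]; what this changes on [A] is restored by [p \o s]. *)
have [g1 g1E] := BN' _ _ _ _ fV alB g.
have [t tE] := ext1_zero_lift (g1 \o be) ip fE fK KN.
have [|t' t'E] := Eext _ _ be t fK fV; first by case: beW.
have [|g3 g3E] := @ses_desc R _ _ _ _ be pW (g1 \- (p \o t')) beW.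
  by move=> k /=; rewrite t'E tE subrr.
have [|s sE] := Eext _ _ a (t' \o al) fA fW; first by case: aw.
exists (g3 \+ (p \o s)) => x /=.
by rewrite -[in g3 _]pWal g3E /= g1E sE /= subrK.
Qed.

Lemma ext1_zero_syzygy K P X N E N' (j : {linear K -> P}) (q : {linear P -> X})
    (i : {linear N -> E}) (p : {linear E -> N'}) :
  ses j q -> ses i p -> projective_mod P -> injective_mod E ->
  ext1_zero X N' -> ext1_zero K N.
Proof.
move=> jq ip [fP Pl] Einj XN'; apply: (ext1_zero_of_lift ip Einj) => f.
have [h hE] := XN' _ _ _ _ fP jq f; case: (ip) => i_inj p_surj _.
have fE := Einj.1.
have [g gE] := Pl _ _ p h fE (ses_fgr ip fE) p_surj.
by exists (g \o j) => x /=; rewrite gE hE.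
Qed.

(** Degree 0 is Hom. From degree 2 on, the condition is imposed on all first syzygies, so
    independence of the presentation never arises. *)
Fixpoint ext_zero (i : nat) X N : Prop :=
  match i with
  | 0 => forall (f : {linear X -> N}) x, f x = 0
  | 1 => ext1_zero X N
  | i'.+1 => forall K P (j : {linear K -> P}) (q : {linear P -> X}),
      projective_mod P -> ses j q -> ext_zero i' K N
  end.

Lemma ext_zero_inj i X N : injective_mod N -> ext_zero i.+1 X N.
Proof.
move=> Ninj; elim: i X => [|i IH] X; first exact: ext1_zero_inj.
by move=> K P j q _ _; apply: IH.
Qed.

(** The stretch Ext^i(X, C) -> Ext^{i+1}(X, A) -> Ext^{i+1}(X, B) of the long exact sequence. *)
Lemma ext_zero_sub i X A B C (a : {linear A -> B}) (p : {linear B -> C}) :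
  ses a p -> finitely_generated B -> ext_zero i.+1 X B -> ext_zero i X C ->
  ext_zero i.+1 X A.
Proof.
move=> ap fB; case: i => [|i] in X *.
  move=> XB XC A' W u w fW uw g.
  have [h hE] := XB _ _ _ _ fW uw (a \o g).
  have [|c cE] := @ses_desc R _ _ _ _ u w (p \o h) uw.
    by move=> x /=; rewrite hE (ses0 ap).
  have [|k kE] := @ses_lift R _ _ _ _ a p h ap.
    by move=> x; rewrite -[LHS]cE XC.
  by exists k => x; case: ap => a_inj _ _; apply: a_inj; rewrite kE hE.
elim: i X => [|i IH] X XB XC K P j q Pp jq; last first.
  by apply: IH; [exact: XB Pp jq | exact: XC Pp jq].
have KB := XB _ _ _ _ Pp jq; have [fP Pl] := Pp.
move=> A' W u w fW uw g.
have [h hE] := KB _ _ _ _ fW uw (a \o g).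
have [|c cE] := @ses_desc R _ _ _ _ u w (p \o h) uw.
  by move=> x /=; rewrite hE (ses0 ap).
have [c' c'E] := XC _ _ _ _ fP jq c.
case: (ap) => a_inj p_surj _.
have [b bE] := Pl _ _ p c' fB (ses_fgr ap fB) p_surj.
have [|k kE] := @ses_lift R _ _ _ _ a p (h \- (b \o (j \o w))) ap.
  by move=> x /=; rewrite linearB bE c'E cE subrr.
exists k => x; apply: a_inj.
by rewrite kE /= hE (ses0 uw) (linear0 j) (linear0 b) [LHS]subr0.
Qed.

(** The stretch Ext^i(X, B) -> Ext^i(X, C) -> Ext^{i+1}(X, A) of the long exact sequence. *)
Lemma ext_zero_quot i X A B C (a : {linear A -> B}) (p : {linear B -> C}) :
  ses a p -> finitely_generated B -> finitely_generated X ->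
  ext_zero i.+1 X A -> ext_zero i X B -> ext_zero i X C.
Proof.
move=> ap fB; case: i => [|i] in X *.
  move=> fX XA XB f x; have [g gE] := ext1_zero_lift f ap fB fX XA.
  by rewrite -gE XB linear0.
elim: i X => [|i IH] X fX XA XB; last first.
  move=> K P j q Pp jq; apply: IH; first exact: ses_fgl jq Pp.1.
    exact: XA Pp jq.
  exact: XB Pp jq.
have [m [K [j [q jq]]]] := free_cover fX.
apply: (ext1_zero_of_presentation (projective_row R m) jq) => f.
have fK := ses_fgl jq (fg_row R m).
have KA := XA _ _ _ _ (projective_row R m) jq.
have [g gE] := ext1_zero_lift f ap fB fK KA.
have [h hE] := XB _ _ _ _ (fg_row R m) jq g.
by exists (p \o h) => k /=; rewrite hE gE.
Qed.

Lemma ext_zero_shiftl i X N E N' (a : {linear N -> E}) (p : {linear E -> N'}) :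
  ses a p -> injective_mod E -> ext_zero i.+1 X N' -> ext_zero i.+2 X N.
Proof.
move=> ap Einj; elim: i X => [|i IH] X XN' K P j q Pp jq.
  exact: ext1_zero_syzygy jq ap Pp Einj XN'.
exact/IH/(XN' _ _ _ _ Pp jq).
Qed.

Lemma ext_zero_shiftr i X N E N' (a : {linear N -> E}) (p : {linear E -> N'}) :
  ses a p -> injective_mod E -> finitely_generated X ->
  ext_zero i.+2 X N -> ext_zero i.+1 X N'.
Proof.
move=> ap Einj; elim: i X => [|i IH] X fX XN.
  have [m [K [j [q jq]]]] := free_cover fX.
  have Pp := projective_row R m.
  have KN := XN _ _ _ _ Pp jq.
  exact: (ext1_zero_shift jq ap (fg_row R m) Einj KN (ext1_zero_proj (N := N') Pp)).
move=> K P j q Pp jq; apply: IH; last exact: XN Pp jq.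
exact: ses_fgl jq Pp.1.
Qed.

End Ext.

(** * Finite length *)

Section Ranked.
Variable R : pzRingType.
Implicit Types M N X : lmodType R.

(* A strictly increasing natural number valued function on the submodules of  *)
(* U; it plays the role of the length of U.                                   *)
Definition ranked_in M (U : M -> Prop) : Prop :=
  exists r : (M -> Prop) -> nat, forall V W, is_submod V -> is_submod W ->
    (forall x, V x -> W x) -> (forall x, W x -> U x) ->
    (r V <= r W)%N /\ ((r W <= r V)%N -> forall x, W x -> V x).

Definition ranked M : Prop := ranked_in (fun _ : M => True).

Lemma ranked_in_sub M (U V : M -> Prop) :
  (forall x, U x -> V x) -> ranked_in V -> ranked_in U.
Proof. by move=> UV [r rP]; exists r => W W' ? ? ? h; apply: rP => // x /h/UV. Qed.

Lemma leq_add_inv (a b c d : nat) :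
  (a <= b)%N -> (c <= d)%N -> (b + d <= a + c)%N -> (b <= a)%N /\ (d <= c)%N.
Proof.
move=> ab cd h; split.
  by rewrite -(leq_add2r d) (leq_trans h) // leq_add2l.
by rewrite -(leq_add2l b) (leq_trans h) // leq_add2r.
Qed.

(** The rank of [W] is that of its intersection with the kernel plus that of its image; nested
    submodules agreeing in both are equal. *)
Lemma ranked_in_ext M N (f : {linear M -> N}) (U : M -> Prop) : is_submod U ->
  ranked_in (fun x => U x /\ f x = 0) ->
  ranked_in (fun y => exists2 x, U x & f x = y) -> ranked_in U.
Proof.
move=> Us [r rP] [s sP].
exists (fun W => addn (r (fun x => W x /\ f x = 0)) (s (fun y => exists2 x, W x & f x = y))).
move=> V W Vs Ws VW WU.
have [||||r1 r2] := rP (fun x => V x /\ f x = 0) (fun x => W x /\ f x = 0).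
- exact: is_submodI Vs (is_submod_ker f).
- exact: is_submodI Ws (is_submod_ker f).
- by move=> x [/VW].
- by move=> x [/WU].
have [||||s1 s2] := sP (fun y => exists2 x, V x & f x = y) (fun y => exists2 x, W x & f x = y).
- exact: is_submod_im.
- exact: is_submod_im.
- by move=> y [x /VW ? <-]; exists x.
- by move=> y [x /WU ? <-]; exists x.
split; first exact: leq_add.
move=> /(leq_add_inv r1 s1)[/r2 rWV /s2 sWV] x Wx.
have [|v Vv fv] := sWV (f x); first by exists x.
have [|Vxv _] := rWV (x - v).
  by split; [apply: is_submodB => //; apply: VW | rewrite linearB fv subrr].
by rewrite -[x](subrK v); apply: is_submodD.
Qed.

Lemma ranked_in_im M N (f : {linear M -> N}) (U : M -> Prop) : is_submod U ->
  ranked_in U -> ranked_in (fun y => exists2 x, U x & f x = y).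
Proof.
move=> Us [r rP]; exists (fun W => r (fun x => U x /\ W (f x))).
move=> V W Vs Ws VW WU.
have [||||r1 r2] := rP (fun x => U x /\ V (f x)) (fun x => U x /\ W (f x)).
- by apply: is_submodI => //; apply: is_submod_preim.
- by apply: is_submodI => //; apply: is_submod_preim.
- by move=> x [? /VW].
- by move=> x [].
split=> // /r2 h y Wy; have [x Ux xy] := WU y Wy.
by case: (h x); rewrite xy.
Qed.

Lemma ranked_in_add M (U V : M -> Prop) : is_submod U -> is_submod V ->
  ranked_in U -> ranked_in V ->
  ranked_in (fun x => exists u v, [/\ U u, V v & x = u + v]).
Proof.
move=> Us Vs rU rV.
have [Q [p [p_surj pK]]] := quotient_exists Vs.
apply: (@ranked_in_ext M Q p); first exact: is_submodS.
  by apply: ranked_in_sub rV => x [_ /pK].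
apply: ranked_in_sub (ranked_in_im p Us rU) => y [_ [u [v [Uu /pK pv ->]]] <-].
by exists u => //; rewrite linearD pv addr0.
Qed.

Lemma ranked_in_simple M (U : M -> Prop) :
  (forall V, is_submod V -> (forall x, V x -> U x) ->
     (forall x, V x -> x = 0) \/ (forall x, U x -> V x)) -> ranked_in U.
Proof.
move=> Usimple; exists (fun W => nat_of_bool `[< exists2 x, W x & x <> 0 >]).
move=> V W Vs Ws VW WU; split.
  case: asboolP => // -[x /VW Wx x0]; case: asboolP => // -[].
  by exists x.
case: asboolP => [_|W0].
  case: asboolP => // -[y Vy y0] _ x Wx.
  case: (Usimple V Vs) => [z /VW/WU //|V0|UV]; last by apply/UV/WU.
  by case: y0; apply: V0.
move=> _ x Wx; suff -> : x = 0 by case: Vs.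
by apply: contrapT => x0; apply: W0; exists x.
Qed.

(** Allowing an arbitrary ranked source covers both [R]-spans ([ranked_fg]) and [L]-spans measured
    over [k] ([artin_algebra_restriction]). *)
Lemma ranked_in_sum M X (m : nat) (h : 'I_m -> {linear X -> M}) : ranked X ->
  ranked_in (fun x => exists c : 'I_m -> X, x = \sum_i h i (c i)).
Proof.
move=> rX; elim: m h => [|m IH] h.
  apply: ranked_in_simple => V _ VU; left=> x /VU[c ->].
  by rewrite big_ord0.
pose h' i := h (widen_ord (leqnSn m) i).
have Us : is_submod (fun x => exists c : 'I_m -> X, x = \sum_i h' i (c i)).
  split; first by exists (fun=> 0); rewrite big1 // => i _; rewrite linear0.
  move=> a _ _ [c ->] [d ->]; exists (fun i => a *: c i + d i).
  by rewrite scaler_sumr -big_split; apply: eq_bigr => i _; rewrite linearP.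
have Vs := is_submod_im (h ord_max) (is_submodT X).
have rV := ranked_in_im (h ord_max) (is_submodT X) rX.
apply: ranked_in_sub (ranked_in_add Us Vs (IH h') rV) => x [c ->].
exists (\sum_i h' i (c (widen_ord (leqnSn m) i))), (h ord_max (c ord_max)).
rewrite big_ord_recr; split=> //; last by exists (c ord_max).
by exists (fun i => c (widen_ord (leqnSn m) i)).
Qed.

Lemma linear_scale M (x : M) : exists f : {linear R^o -> M}, forall a : R, f a = a *: x.
Proof. by apply: linear_of => a b c; rewrite scalerDl scalerA. Qed.

Lemma ranked_fg M : ranked R^o -> finitely_generated M -> ranked M.
Proof.
move=> rR [m [g gM]].
have [h hE] := choice (fun i : 'I_m => linear_scale (g i)).
apply: ranked_in_sub (ranked_in_sum h rR) => x _.
by have [c ->] := gM x; exists c; apply: eq_bigr => i _; rewrite hE.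
Qed.

Lemma ranked_inj M N (i : {linear M -> N}) : injective i -> ranked N -> ranked M.
Proof.
move=> i_inj rN; apply: (ranked_in_ext (f := i)) => //; last by apply: ranked_in_sub rN.
apply: ranked_in_simple => V Vs V0; left=> x /V0[_ ix].
by apply: i_inj; rewrite ix linear0.
Qed.

Lemma ranked_max M (T : (M -> Prop) -> Prop) U0 : ranked M ->
  is_submod U0 -> T U0 ->
  exists U, [/\ is_submod U, T U & forall V, is_submod V -> T V ->
    (forall x, U x -> V x) -> forall x, V x -> U x].
Proof.
move=> [r rP] U0s TU0.
have rb V : is_submod V -> (r V <= r (fun=> True))%N.
  by move=> Vs; case: (rP V (fun=> True)).
pose t n := `[< exists V, [/\ is_submod V, T V & r V = n] >].
have [||n /asboolP[U [Us TU rU]] nmax] := @ex_maxnP t (r (fun=> True)).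
- by exists (r U0); apply/asboolP; exists U0.
- by move=> n /asboolP[V [Vs _ <-]]; apply: rb.
exists U; split=> // V Vs TV UV.
have [//|_] := rP U V Us Vs UV.
by apply; rewrite rU; apply: nmax; apply/asboolP; exists V.
Qed.

Lemma ranked_min M (T : (M -> Prop) -> Prop) U0 : ranked M ->
  is_submod U0 -> T U0 ->
  exists U, [/\ is_submod U, T U & forall V, is_submod V -> T V ->
    (forall x, V x -> U x) -> forall x, U x -> V x].
Proof.
move=> [r rP] U0s TU0.
pose t n := `[< exists V, [/\ is_submod V, T V & r V = n] >].
have [|n /asboolP[U [Us TU rU]] nmin] := @ex_minnP t.
  by exists (r U0); apply/asboolP; exists U0.
exists U; split=> // V Vs TV VU.
have [x Ux|_ h] := rP V U Vs Us VU; first by [].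
by apply: h; rewrite rU; apply: nmin; apply/asboolP; exists V.
Qed.

Definition span M m (g : 'I_m -> M) (x : M) : Prop :=
  exists c : 'I_m -> R, x = \sum_i c i *: g i.

Lemma is_submod_span M m (g : 'I_m -> M) : is_submod (span g).
Proof.
split; first by exists (fun=> 0); rewrite big1 // => i _; rewrite scale0r.
move=> a _ _ [c ->] [d ->]; exists (fun i => a * c i + d i).
by rewrite scaler_sumr -big_split; apply: eq_bigr => i _; rewrite scalerDl scalerA.
Qed.

Lemma span_mem M m (g : 'I_m -> M) i : span g (g i).
Proof.
exists (fun j => (j == i)%:R); rewrite (bigD1 i) //= eqxx scale1r big1 ?addr0 //.
by move=> j /negbTE ->; rewrite scale0r.
Qed.

(** A maximal finitely generated submodule absorbs every further generator. *)
Lemma fg_ranked M : ranked M -> finitely_generated M.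
Proof.
move=> rM.
pose T (U : M -> Prop) := exists m (g : 'I_m -> M), forall x, U x <-> span g x.
have [|U [_ [m [g gU]] Umax]] := @ranked_max M T _ rM (is_submod_span (fun _ : 'I_0 => 0)).
  by exists 0, (fun=> 0).
exists m, g => x; apply/gU.
pose g' (i : 'I_(m + 1)) := match split i with inl j => g j | inr _ => x end.
apply: (Umax (span g')); [exact: is_submod_span|by exists (m + 1)%N, g'| |].
  move=> y /gU[c ->]; apply: is_submod_sum; first exact: is_submod_span.
  move=> i _; apply: is_submodZ; first exact: is_submod_span.
  have := span_mem g' (lshift 1 i).
  by rewrite /g' (unsplitK (inl i) : split (lshift 1 i) = _).
have := span_mem g' (rshift m ord0).
by rewrite /g' (unsplitK (inr ord0) : split (rshift m ord0) = _).
Qed.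

End Ranked.

(* Hopkins: take an ideal B minimal among those without rank.  Each a in k    *)
(* acts on B either as 0 or surjectively, so the annihilator of B is prime,   *)
(* hence maximal by the descending chain condition, and B is a vector space   *)
(* all of whose proper subspaces are ranked.                                  *)
Lemma artinian_ranked (k : comPzRingType) : artinian k^o -> ranked k^o.
Proof.
move=> k_art.
have dcc (T : (k^o -> Prop) -> Prop) U0 : is_submod U0 -> T U0 ->
    exists U, [/\ is_submod U, T U & forall V, is_submod V -> T V ->
      (forall x, V x -> U x) -> forall x, U x -> V x].
  move=> U0s TU0; apply: contrapT => noU.
  pose D := {U : k^o -> Prop | is_submod U /\ T U}.
  have /choice[f fP] (U : D) : exists V : D,
      (forall x, sval V x -> sval U x) /\ exists2 x, sval U x & ~ sval V x.
    case: U => U [Us TU] /=; apply: contrapT => noV; apply: noU; exists U; split=> //.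
    move=> V Vs TV VU x Ux; apply: contrapT => Vx; apply: noV.
    by exists (exist _ V (conj Vs TV)); split=> //; exists x.
  pose u i := iter i f (exist _ U0 (conj U0s TU0)).
  have [v vE] := choice (fun i => submodClosed_of (svalP (u i)).1).
  have [|m mE] := k_art v.
    by move=> i x /vE; rewrite /u /= => /(fP _).1 ?; apply/vE.
  have [_ [x xm xm']] := fP (u m).
  by apply: xm'; apply/(vE m.+1); rewrite mE //; apply/vE.
apply: contrapT => knr.
have [B [Bs Bnr Bmin]] := dcc (fun U => ~ ranked_in U) _ (is_submodT k^o) knr.
have Bproper V : is_submod V -> (forall x, V x -> B x) -> (exists2 x, B x & ~ V x) ->
    ranked_in V.
  move=> Vs VB [x Bx Vx]; apply: contrapT => Vnr.
  by apply: Vx; apply: Bmin.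
have mulB (a x : k^o) : B x -> B (a * x : k^o).
  by move=> Bx; apply: (@is_submodZ k k^o B a x).
(* If both alternatives fail, the kernel of [a] on [B] and the image aB are proper in [B], hence
   ranked, and so is [B]. *)
have act (a : k) : (forall x, B x -> a * x = 0) \/ (forall x, B x -> exists2 y, B y & a * y = x).
  have [f fE] : exists f : {linear k^o -> k^o}, forall x, f x = a * x.
    by apply: linear_of => b x y; rewrite mulrDr /GRing.scale /= mulrCA.
  apply: contrapT => /not_orP[/existsNP[x /not_implyP[Bx ax]] /existsNP[y /not_implyP[By ay]]].
  apply: Bnr; apply: (ranked_in_ext (f := f)) => //.
    apply: Bproper; [exact: is_submodI Bs (is_submod_ker f)|by move=> z []|].
    by exists x => // -[_]; rewrite fE.
  apply: Bproper; [exact: is_submod_im|by move=> _ [z Bz <-]; rewrite fE; apply: mulB|].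
  by exists y => // -[z Bz]; rewrite fE => e; apply: ay; exists z.
have inv (a : k) : (forall x, B x -> a * x = 0) \/
    exists c, forall x, B x -> c * (a * x) = x.
  have [|asurj] := act a; [by left|right].
  have pw n : is_submod (fun x : k^o => exists y, x = y * a ^+ n).
    split=> [|b _ _ [y ->] [z ->]]; first by exists 0; rewrite mul0r.
    by exists (b * y + z); rewrite mulrDl -mulrA.
  (* The powers of [a] generate a stationary chain of ideals, so a^n = c a^{n+1}. As [a] is onto on
     [B], every x in [B] is some a^n z, whence c a x = x. *)
  have [_ [_ [n ->] nmin]] := dcc (fun U => exists n, U = fun x : k^o => exists y, x = y * a ^+ n)
     _ (pw 0) (ex_intro _ 0 erefl).
  have [||c cE] := nmin _ (pw n.+1) (ex_intro _ n.+1 erefl) _ (a ^+ n).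
  - by move=> _ [y ->]; exists (y * a); rewrite exprS mulrA.
  - by exists 1; rewrite mul1r.
  exists c => x Bx.
  have [z Bz <-] : exists2 z, B z & a ^+ n * z = x.
    elim: n {nmin cE} => [|n IH]; first by exists x; rewrite ?mul1r.
    have [z Bz <-] := IH; have [w Bw <-] := asurj z Bz.
    by exists w; rewrite // exprSr mulrA.
  by rewrite mulrA mulrA -(mulrA c) -exprS -cE.
have [x Bx x0] : exists2 x, B x & x <> 0.
  apply: contrapT => B0; apply: Bnr; apply: ranked_in_simple => V _ VB; left=> x Vx.
  by apply: contrapT => x0; apply: B0; exists x; [apply: VB|].
have [C [[Cs CB Cx] Cmax]] : exists C : k^o -> Prop,
    [/\ is_submod C, forall y, C y -> B y & ~ C x] /\
    forall D : k^o -> Prop, [/\ is_submod D, forall y, D y -> B y & ~ D x] ->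
      (forall y, C y -> D y) -> forall y, D y -> C y.
  (* [P] does not ask for 0, because the union of the empty chain must satisfy it; maximality puts 0
     back. *)
  pose P (C : set k^o) := [/\ forall (a : k) y z, C y -> C z -> C (a *: y + z),
                            forall y, C y -> B y & ~ C x].
  have [|C [[Ccl CB Cx] Cmax]] := @Zorn_bigcup k^o P.
    move=> F FP Ftot; split=> [a y z [V FV Vy] [W FW Wz]|y [V FV Vy]|[V FV Vx]].
    - have [VW|WV] := Ftot V W FV FW.
        by exists W => //; have [cl _ _] := FP W FW; apply: cl => //; apply: VW.
      by exists V => //; have [cl _ _] := FP V FV; apply: cl => //; apply: WV.
    - by have [_ VB _] := FP V FV; apply: VB.
    - by have [_ _] := FP V FV.
  have C0 : C 0.
    apply: contrapT => C0; apply: (Cmax (fun y => C y \/ y = 0)).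
      by split=> [y|CC]; [left | apply/C0/CC; right].
    have nC y : ~ C y.
      by move=> Cy; apply: C0; have := Ccl (-1) y y Cy Cy; rewrite scaleN1r addNr.
    split=> [a y z /= [Cy|->] [Cz|->]|y [/CB //|->]|[//|/esym //]].
    + by left; apply: Ccl.
    + by case: (nC y).
    + by rewrite scaler0 add0r; left.
    + by rewrite scaler0 add0r; right.
    + by case: Bs.
  exists C; split; first by split.
  move=> D [[D0 Dcl] DB Dx] CD y Dy; apply: contrapT => Cy.
  by apply: (Cmax D); [split=> // DC; apply/Cy/DC | split].
have kxs := is_submod1 (x : k^o).
(* By maximality of [C], every y in [B] outside [C] has x in C + ky with an invertibly acting
   coefficient, so B = C + kx. Here [C] is proper in [B] and kx has no proper nonzero submodule. *)
apply: Bnr; apply: ranked_in_sub (ranked_in_add Cs kxs _ _).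
- move=> y By; have [Cy|Cy] := pselect (C y).
    by exists y, 0; rewrite addr0; split=> //; exists 0; rewrite scale0r.
  have Ds := is_submodS Cs (is_submod1 (y : k^o)).
  have Dx : exists u v, [/\ C u, exists a : k, v = a *: (y : k^o) & x = u + v].
    apply: contrapT => Dx; apply: Cy; apply: (Cmax _ (And3 Ds _ Dx)).
    - move=> _ [u [_ [/CB Bu [a ->] ->]]]; apply: is_submodD => //.
      exact: is_submodZ.
    - by move=> u Cu; exists u, 0; rewrite addr0; split=> //; exists 0; rewrite scale0r.
    - by exists 0, y; rewrite add0r; case: (Cs) => C0 _; split=> //; exists 1; rewrite scale1r.
  have [u [_ [Cu [a ->] xE]]] := Dx.
  have [a0|[c cE]] := inv a.
    by case: Cx; rewrite xE [_ *: _]a0 ?addr0.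
  exists (- (c *: u)), (c *: x); split; [|by exists c|].
    by apply: is_submodN => //; apply: is_submodZ.
  by rewrite [in c *: x]xE scalerDr addKr [RHS]cE.
- by apply: Bproper => //; exists x.
- apply: ranked_in_simple => V Vs Vx.
  have [V0|/existsNP[y /not_implyP[Vy y0]]] := pselect (forall y, V y -> y = 0); [by left|right].
  have [a ya] := Vx y Vy.
  have [a0|[c cE]] := inv a; first by case: y0; rewrite ya; apply: a0.
  move=> _ [b ->]; rewrite -[x]cE //.
  apply: is_submodZ => //.
  by have := is_submodZ c Vs Vy; rewrite ya.
Qed.

(** * Artin algebras: length over the base ring and left approximations *)

Definition restriction (k L : pzRingType) (phi : {rmorphism k -> L}) (M : lmodType L) : Type := M.

Section Restriction.
Variables (k L : pzRingType) (phi : {rmorphism k -> L}) (M : lmodType L).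

HB.instance Definition _ := GRing.Zmodule.on (restriction phi M).

Definition restriction_scale (a : k) (x : restriction phi M) : restriction phi M :=
  phi a *: (x : M).

Lemma restriction_scaleA a b x :
  restriction_scale a (restriction_scale b x) = restriction_scale (a * b) x.
Proof. by rewrite /restriction_scale scalerA rmorphM. Qed.

Lemma restriction_scale1 : left_id 1 restriction_scale.
Proof. by move=> x; rewrite /restriction_scale rmorph1 scale1r. Qed.

Lemma restriction_scaleDr : right_distributive restriction_scale +%R.
Proof. by move=> a x y; rewrite /restriction_scale scalerDr. Qed.

Lemma restriction_scaleDl x : {morph (fun a => restriction_scale a x) : a b / a + b}.
Proof. by move=> a b; rewrite /restriction_scale rmorphD scalerDl. Qed.

HB.instance Definition _ := GRing.Zmodule_isLmodule.Build k (restriction phi M)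
  restriction_scaleA restriction_scale1 restriction_scaleDr restriction_scaleDl.

Lemma restriction_scaleE (a : k) (x : restriction phi M) : a *: x = phi a *: (x : M) :> M.
Proof. by []. Qed.

Lemma is_submod_restriction (U : M -> Prop) :
  is_submod U -> is_submod (U : restriction phi M -> Prop).
Proof. by move=> [U0 UD]; split=> // a x y Ux Uy; apply: UD. Qed.

Lemma ranked_restriction : ranked (restriction phi M) -> ranked M.
Proof.
move=> [r rP]; exists r => V W /is_submod_restriction Vs /is_submod_restriction Ws.
exact: rP.
Qed.

End Restriction.

Lemma linear_restriction (k L : pzRingType) (phi : {rmorphism k -> L}) (M N : lmodType L)
    (f : {linear M -> N}) :
  exists g : {linear restriction phi M -> restriction phi N}, forall x, g x = f x.
Proof. by apply: linear_of => a x y; rewrite !restriction_scaleE linearP. Qed.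

Section ArtinAlgebra.
Variable L : pzRingType.
Hypothesis artinL : artin_algebra L.
Implicit Types M N K X : lmodType L.

Lemma artin_algebra_restriction :
  exists (k : pzRingType) (phi : {rmorphism k -> L}),
    (forall a x, phi a * x = x * phi a) /\
    forall M, finitely_generated M -> ranked (restriction phi M).
Proof.
have [k [phi [/artinian_ranked rk phiC [m [g gL]]]]] := artinL.
exists k, phi; split=> // M [p [h hM]].
have rL : ranked (restriction phi L^o).
  by apply: ranked_fg rk _; exists m, g => x; have [c ->] := gL x; exists c.
have [f fE] := choice (fun i : 'I_p => linear_scale (h i)).
have [f' f'E] := choice (fun i : 'I_p => linear_restriction phi (f i)).
apply: ranked_in_sub (ranked_in_sum f' rL) => x _.
by have [c ->] := hM x; exists c; apply: eq_bigr => i _; rewrite f'E fE.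
Qed.

Lemma artin_algebra_ranked M : finitely_generated M -> ranked M.
Proof.
have [k [phi [_ h]]] := artin_algebra_restriction.
by move=> /h; apply: ranked_restriction.
Qed.

(** Evaluation at generators of [K] embeds Hom(K, L) in a power of [L], which has finite length over
    [k]. So Hom(K, L) has finitely many generators over [k], and they are the coordinates of [F]. *)
Lemma left_approximation K : finitely_generated K ->
  exists m (F : {linear K -> 'rV[L]_m}), forall f : {linear K -> L^o},
    exists h : {linear 'rV[L]_m -> L^o}, forall x, h (F x) = f x.
Proof.
move=> [p [g gK]]; have [k [phi [phiC rk]]] := artin_algebra_restriction.
pose row (f : {linear K -> L^o}) : restriction phi 'rV[L]_p := \row_i f (g i).
have Us : is_submod (fun v : restriction phi 'rV[L]_p => exists f, v = row f).
  split; first by exists \0; apply/rowP => i; rewrite !mxE.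
  move=> a _ _ [f1 ->] [f2 ->].
  (* Multiplying on the right keeps the map [L]-linear; on rows it is the [k]-action because [phi a]
     is central. *)
  have [f fE] : exists f : {linear K -> L^o}, forall x, f x = f1 x * phi a + f2 x.
    apply: linear_of => b x y; rewrite !linearP mulrDl scalerDr addrACA.
    by rewrite -[b *: f1 x]/(b * f1 x) -mulrA.
  exists f; apply/rowP => i; rewrite !mxE fE -phiC; congr (_ + _).
have [V [i [i_inj iV]]] := submodule_exists Us.
have [m [v vV]] := fg_ranked (ranked_inj i_inj (rk _ (fg_row L p))).
have [f fE] := choice (fun j : 'I_m => (iV (i (v j))).2 (ex_intro _ (v j) erefl)).
have [F FE] := linear_to_row f.
exists m, F => f0.
have [w wE] := (iV (row f0)).1 (ex_intro _ f0 erefl).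
have [c cE] := vV w.
have [h hE] := linear_from_row (fun j => phi (c j) : L^o).
exists h => x; have [d ->] := gK x.
rewrite !linear_sum; apply: eq_bigr => l _; rewrite !linearZ; congr (_ *: _).
rewrite hE; transitivity ((row f0 : 'rV[L]_p) 0 l); last by rewrite mxE.
rewrite -wE cE linear_sum summxE.
apply: eq_bigr => j _; rewrite linearZ /= fE FE.
by rewrite restriction_scaleE !mxE phiC.
Qed.

End ArtinAlgebra.

(** * Gorenstein projective dimension *)

Section GorensteinProjective.
Variable R : pzRingType.
Implicit Types C G K M N P : lmodType R.

Lemma gorenstein_projective_coker M : gorenstein_projective M ->
  exists P C (j : {linear M -> P}) (q : {linear P -> C}),
    [/\ ses j q, projective_mod P & gorenstein_projective C].
Proof.
move=> [P [d [dP [i [e [e_inj eE]]]]]]; have [Pproj dex _] := dP.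
have [C [c [c_inj cE]]] := submodule_exists (is_submod_im (d (1 + i)) (is_submodT _)).
have [q qE] := @factor_inj _ _ _ _ c (d (1 + i)) c_inj
  (fun x => (cE _).1 (ex_intro2 _ _ x I erefl)).
exists (P (1 + i)), C, e, q; split=> //.
  split=> // [x|y].
    have [y _ yE] := (cE (c x)).2 (ex_intro _ x erefl).
    by exists y; apply: c_inj; rewrite qE.
  rewrite eE -(dex i) -qE; split=> [->|h]; first by rewrite linear0.
  by apply: c_inj; rewrite h linear0.
exists P, d; split=> //; exists (1 + i), c; split=> // y; rewrite -cE.
by split=> [[x]|[x]]; exists x.
Qed.

(** The last clause is exactness of the dual complex; it amounts to Ext^1(M, R) = 0. *)
Lemma gorenstein_projective_ker M : gorenstein_projective M ->
  exists K P (j : {linear K -> P}) (q : {linear P -> M}),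
    [/\ ses j q, projective_mod P, gorenstein_projective K &
        forall f : {linear K -> R^o}, exists h : {linear P -> R^o}, forall x, h (j x) = f x].
Proof.
move=> [P [d [dP [i [e [e_inj eE]]]]]]; have [Pproj dex dhom] := dP.
have [i' ii'] : exists i', i = 1 + i' by exists (- 1 + i); rewrite addNKr.
subst i.
have [K [j [j_inj jE]]] := submodule_exists (is_submod_im (d i') (is_submodT _)).
have [q qE] := @factor_inj _ _ _ _ e (d (1 + i')) e_inj
  (fun x => (eE _).2 (ex_intro _ x erefl)).
exists K, (P (1 + i')), j, q; split=> //.
- split=> // [x|y].
    have [y yE] := (eE (e x)).1 (ex_intro _ x erefl).
    by exists y; apply: e_inj; rewrite qE.
  rewrite -jE; have -> : (exists2 x, True & d i' x = y) <-> (exists x, d i' x = y).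
    by split=> [[x]|[x]]; exists x.
  rewrite -(dex i') -qE; split=> [->|h]; first by rewrite linear0.
  by apply: e_inj; rewrite h linear0.
- exists P, d; split=> //; exists i', j; split=> // y; rewrite -jE.
  by split=> [[x]|[x]]; exists x.
have [i'' ii''] : exists i'', i' = 1 + i'' by exists (- 1 + i'); rewrite addNKr.
subst i' => f.
have [c cE] := @factor_inj _ _ _ _ j (d (1 + i'')) j_inj
  (fun x => (jE _).1 (ex_intro2 _ _ x I erefl)).
have [|h hE] := (dhom i'' (f \o c)).1.
  move=> x /=; suff -> : c (d i'' x) = 0 by rewrite linear0.
  by apply: j_inj; rewrite cE linear0; apply/dex; exists x.
exists h => x; have [y _ yE] := (jE (j x)).2 (ex_intro _ x erefl).
by rewrite -yE hE /=; congr (f _); apply: j_inj; rewrite cE.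
Qed.

Lemma gorenstein_projective_splice (Z P : int -> lmodType R)
    (j : forall i, {linear Z i -> P i}) (q : forall i, {linear P i -> Z (1 + i)}) (i : int) :
  (forall i, ses (j i) (q i)) -> (forall i, projective_mod (P i)) ->
  (forall i (f : {linear Z i -> R^o}),
     exists h : {linear P i -> R^o}, forall x, h (j i x) = f x) ->
  gorenstein_projective (Z (1 + i)).
Proof.
move=> jq Pproj Pext.
have jinj l : injective (j l) by case: (jq l).
have qsurj l : surjective (q l) by case: (jq l).
have jqex l : exact (j l) (q l) by case: (jq l).
exists P, (fun i => j (1 + i) \o q i); split; last first.
  exists i, (j (1 + i)); split=> // y; split=> [[x <-]|[x <-]]; last by exists (q i x).
  by have [z <-] := qsurj i x; exists z.
split=> // [l y|l f] /=.
  split=> [h|[x <-]]; last by rewrite (ses0 (jq _)) linear0.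
  have /jqex[z <-] : q (1 + l) y = 0 by apply: jinj; rewrite h linear0.
  by have [x <-] := qsurj l z; exists x.
split=> [f0|[g gE] x]; last by rewrite -gE /= (ses0 (jq _)) !linear0.
have [|f' f'E] := @ses_desc _ _ _ _ _ _ _ f (jq (1 + l)).
  by move=> z; have [x <-] := qsurj l z; apply: f0.
have [g gE] := Pext _ f'; exists g => x.
by rewrite gE f'E.
Qed.

(** Coinduction: a class closed under suitable cokernels and kernels builds, from any of its
    members, a totally acyclic complex in both directions. *)
Lemma gorenstein_projective_coind (T : lmodType R -> Prop) :
  (forall M, T M -> exists P C (j : {linear M -> P}) (q : {linear P -> C}),
     [/\ ses j q, projective_mod P, T C &
       forall f : {linear M -> R^o}, exists h : {linear P -> R^o}, forall x, h (j x) = f x]) ->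
  (forall M, T M -> exists K P (j : {linear K -> P}) (q : {linear P -> M}),
     [/\ ses j q, projective_mod P, T K &
       forall f : {linear K -> R^o}, exists h : {linear P -> R^o}, forall x, h (j x) = f x]) ->
  forall M, T M -> gorenstein_projective M.
Proof.
move=> Tup Tdown M TM.
pose D := {M : lmodType R | T M}.
pose good (A C P : lmodType R) (j : {linear A -> P}) (q : {linear P -> C}) :=
  [/\ ses j q, projective_mod P &
      forall f : {linear A -> R^o}, exists h : {linear P -> R^o}, forall x, h (j x) = f x].
have /choice[up upP] (N : D) : exists N' : D,
    exists P (j : {linear sval N -> P}) (q : {linear P -> sval N'}), good _ _ _ j q.
  case: N => N' TN'; have [P [C [j [q [jq Pp TC e]]]]] := Tup _ TN'.
  by exists (exist _ C TC), P, j, q.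
have /choice[down downP] (N : D) : exists N' : D,
    exists P (j : {linear sval N' -> P}) (q : {linear P -> sval N}), good _ _ _ j q.
  case: N => N' TN'; have [K [P [j [q [jq Pp TK e]]]]] := Tdown _ TN'.
  by exists (exist _ K TK), P, j, q.
pose M0 : D := exist _ M TM.
(* [Negz j] is -(j + 1), hence [j.+1] kernels. [M] is [Z 0], which is [Z (1 + Negz 0)], so the
   splice is applied at [Negz 0]. *)
pose Z (i : int) : lmodType R := match i with
  | Posz j => sval (iter j up M0) | Negz j => sval (iter j.+1 down M0) end.
have step (i : int) : exists P (j : {linear Z i -> P}) (q : {linear P -> Z (1 + i)}),
    good _ _ _ j q.
  case: i => [l|[|[|l]]]; [exact: (upP (iter l up M0))|exact: (downP M0)|exact: (downP (down M0))|].
  exact: (downP (iter l.+2 down M0)).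
pose P i := projT1 (cid (step i)).
pose j i : {linear Z i -> P i} := projT1 (cid (projT2 (cid (step i)))).
pose q i : {linear P i -> Z (1 + i)} := projT1 (cid (projT2 (cid (projT2 (cid (step i)))))).
have jqP i : good _ _ _ (j i) (q i) := projT2 (cid (projT2 (cid (projT2 (cid (step i)))))).
exact: (@gorenstein_projective_splice Z P j q (Negz 0)
  (fun i => let: And3 h _ _ := jqP i in h) (fun i => let: And3 _ h _ := jqP i in h)
  (fun i => let: And3 _ _ h := jqP i in h)).
Qed.

Lemma ses_id M Z : zero_mod Z -> ses (idfun : {linear M -> M}) (\0 : {linear M -> Z}).
Proof.
move=> Z0; split=> //; first by move=> x; exists 0; rewrite linear0 [x]Z0.
by move=> y; split=> // _; exists y.
Qed.

Lemma ses_id0 M Z : zero_mod Z -> ses (\0 : {linear Z -> M}) (idfun : {linear M -> M}).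
Proof.
move=> Z0; split=> //; first by move=> x y _; rewrite [x]Z0 [y]Z0.
  by move=> y; exists y.
by move=> y; split=> /= [->|[_ <-] //]; exists 0.
Qed.

Lemma gorenstein_projective_proj P : projective_mod P -> gorenstein_projective P.
Proof.
have zp := projective_zero (@zero_row0 R).
apply: gorenstein_projective_coind => {}P Pp.
  exists P, 'rV[R]_0, idfun, \0; split=> //; first exact: ses_id (@zero_row0 R).
  by move=> f; exists f.
exists 'rV[R]_0, P, \0, idfun; split=> //; first exact: ses_id0 (@zero_row0 R).
by move=> f; exists \0 => x; rewrite [x]zero_row0 !linear0.
Qed.

Lemma gorenstein_projective_isom M N :
  isomorphic M N -> gorenstein_projective M -> gorenstein_projective N.
Proof.
move=> [f [g fK gK]] [P [d [dP [i [e [e_inj eE]]]]]].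
have [g' g'E] : exists h : {linear N -> M}, forall x, h x = g x.
  by apply: linear_of => a x y; apply: (can_inj fK); rewrite linearP !gK.
exists P, d; split=> //; exists i, (e \o g'); split.
  by apply: inj_comp => // x y; rewrite !g'E => /(can_inj gK).
move=> y; rewrite -eE; split=> [[x <-]|[x <-]]; first by exists (g' x).
by exists (f x); rewrite /= g'E fK.
Qed.

Lemma gorenstein_projective_fg M : gorenstein_projective M -> finitely_generated M.
Proof.
move=> /gorenstein_projective_ker[K [P [j [q [[_ q_surj _] [fP _] _ _]]]]].
exact: fg_surj q_surj fP.
Qed.

(** Resolutions of length [n], peeled off one syzygy at a time; [Gpd_leP] compares this with
    [Gpd_le]. *)
Fixpoint gp_dim_le (n : nat) M : Prop :=
  match n with
  | 0 => gorenstein_projective M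
  | n'.+1 => exists K G (j : {linear K -> G}) (q : {linear G -> M}),
      [/\ ses j q, gorenstein_projective G & gp_dim_le n' K]
  end.

Lemma gp_dim_le_fg n M : gp_dim_le n M -> finitely_generated M.
Proof.
case: n => [|n]; first exact: gorenstein_projective_fg.
move=> [K [G [j [q [[_ q_surj _] /gorenstein_projective_fg fG _]]]]].
exact: fg_surj q_surj fG.
Qed.

Lemma gp_dim_le_isom n M N : isomorphic M N -> gp_dim_le n M -> gp_dim_le n N.
Proof.
case: n => [|n]; first exact: gorenstein_projective_isom.
move=> [f [g fK gK]] [K [G [j [q [[j_inj q_surj jq] GG Kn]]]]].
exists K, G, j, (f \o q); split=> //; split=> //.
  by move=> y; have [x xE] := q_surj (g y); exists x; rewrite /= xE gK.
move=> y; rewrite -jq /=; split=> [h|->]; last exact: linear0.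
by apply: (can_inj fK); rewrite h linear0.
Qed.

Lemma linear_zero_mod M N (f : {linear M -> N}) : zero_mod M -> forall x, f x = 0.
Proof. by move=> M0 x; rewrite [x]M0 linear0. Qed.

Lemma gp_resolution_dim l M (G : nat -> lmodType R) (d : forall j, {linear G j.+1 -> G j})
  (eps : {linear G 0 -> M}) : gp_resolution l d eps -> gp_dim_le l M.
Proof.
elim: l => [|l IH] in M G d eps *; case=> GGP G0 eps_surj ex0 ex.
  apply: gorenstein_projective_isom (GGP 0 _) => //; exists eps.
  have /choice[g gE] := eps_surj; exists g => x; last exact: gE.
  apply/eqP; rewrite -subr_eq0; apply/eqP.
  have /ex0[y <-] : eps (g (eps x) - x) = 0 by rewrite linearB gE subrr.
  exact: linear_zero_mod (G0 1 _) _.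
have [K [i ip]] := ses_ker eps_surj.
have [e eE] := @ses_lift _ _ _ _ _ i eps (d 0) ip (fun x => (ex0 _).2 (ex_intro _ x erefl)).
exists K, (G 0), i, eps; split=> //; first exact: GGP.
have [i_inj _ iex] := ip.
apply: (IH K (fun j => G j.+1) (fun j => d j.+1) e); split=> //.
- by move=> j jl; apply: GGP.
- by move=> j jl; apply: G0.
- move=> x; have /ex0[y yE] : eps (i x) = 0 by apply/iex; exists x.
  by exists y; apply: i_inj; rewrite eE.
move=> y; rewrite -(ex 0) -eE; split=> [->|h]; first by rewrite linear0.
by apply: i_inj; rewrite h linear0.
Qed.

Lemma gp_dim_resolution l M : gp_dim_le l M ->
  exists (G : nat -> lmodType R) (d : forall j, {linear G j.+1 -> G j})
    (eps : {linear G 0 -> M}), gp_resolution l d eps.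
Proof.
elim: l M => [|l IH] M.
  move=> MG.
  exists (fun j => if j is 0 then M else 'rV[R]_0), (fun j => \0), idfun.
  split=> [[]|[]|x|y|j y] //; first by move=> j _; apply: zero_row0.
  - by exists x.
  - by split=> /= [->|[x <-] //]; exists 0.
  by split=> // _; exists 0; rewrite [RHS]zero_row0.
move=> [K [G0 [i [q [[i_inj q_surj iq] GG /IH[G [d [eps [GGP G00 eps_surj ex0 ex]]]]]]]]].
pose G' j := if j is j'.+1 then G j' else G0.
exists G', (fun j => match j return {linear G' j.+1 -> G' j} with
  | 0 => i \o eps | j'.+1 => d j' end), q.
split=> //.
- by case=> [|j] // jl; apply: GGP.
- by case=> [|j] // jl; apply: G00.
- move=> y; rewrite iq; split=> [[x <-]|[x <-]]; last by exists (eps x).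
  by have [z <-] := eps_surj x; exists z.
case=> [|j] //= y; rewrite -(ex0 y); split=> /= [h|->]; last exact: linear0.
by apply: i_inj; rewrite h linear0.
Qed.

Lemma Gpd_leP M n : Gpd_le M n <-> exists2 l, (l <= n)%N & gp_dim_le l M.
Proof.
split=> [[l ln [G [d [eps /gp_resolution_dim Ml]]]]|[l ln /gp_dim_resolution[G [d [eps r]]]]].
  by exists l.
by exists l => //; exists G, d, eps.
Qed.

Lemma Gpd_le_isom M N n : isomorphic M N -> Gpd_le M n -> Gpd_le N n.
Proof.
move=> MN /Gpd_leP[l ln Ml]; apply/Gpd_leP; exists l => //.
exact: gp_dim_le_isom MN Ml.
Qed.

End GorensteinProjective.

(** * Simple modules, essential extensions and indecomposables *)

Section Simple.
Variable R : pzRingType.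
Implicit Types E F M N P Q S X : lmodType R.

Lemma isomorphic_of_bij M N (f : {linear M -> N}) :
  injective f -> surjective f -> isomorphic M N.
Proof.
move=> f_inj /choice[g gE]; exists f; exists g => // x.
by apply: f_inj; rewrite gE.
Qed.

Lemma isomorphic_sym M N : isomorphic M N -> isomorphic N M.
Proof.
move=> [f [g fK gK]].
have [g' g'E] : exists h : {linear N -> M}, forall x, h x = g x.
  by apply: linear_of => a x y; apply: (can_inj fK); rewrite linearP !gK.
by exists g'; exists f => x; rewrite g'E.
Qed.

Lemma simple_modP M : simple_mod M <-> (exists x : M, x <> 0) /\
  forall V : M -> Prop, is_submod V -> (forall x, V x -> x = 0) \/ (forall x, V x).
Proof.
split=> [[nz h]|[[x x0] h]]; split.
- apply: contrapT => h0; apply: nz => x; apply: contrapT => x0.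
  by apply: h0; exists x.
- move=> V /submodClosed_of[W WV].
  by have [W0|WT] := h W; [left=> x /WV/W0 | right=> x; apply/WV/WT].
- by move=> M0; apply: x0; apply: M0.
- by move=> V; apply: (h _ (is_submod_mem V)).
Qed.

Lemma simple_sub_exists M (U : M -> Prop) : ranked M -> is_submod U ->
  (exists2 x, U x & x <> 0) ->
  exists S (i : {linear S -> M}), [/\ injective i, simple_mod S & forall x, U (i x)].
Proof.
move=> rM Us Unz.
have [V [Vs [VU [x Vx x0]] Vmin]] := @ranked_min _ M
  (fun V => (forall x, V x -> U x) /\ exists2 x, V x & x <> 0) U rM Us (conj (fun _ h => h) Unz).
have [S [i [i_inj iV]]] := submodule_exists Vs.
exists S, i; split=> //; last by move=> y; apply/VU/iV; exists y.
apply/simple_modP; split.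
  have [y yx] := (iV x).1 Vx; exists y => y0.
  by apply: x0; rewrite -yx y0 linear0.
move=> W Ws; have [W0|/existsNP[y /not_implyP[Wy y0]]] := pselect (forall y, W y -> y = 0).
  by left.
right=> z; have [|||z' Wz' /i_inj <- //] := Vmin _ (is_submod_im i Ws) _ _ (i z).
- split=> [_ [t _ <-]|]; first by apply/VU/iV; exists t.
  by exists (i y); [exists y | rewrite -(linear0 i) => /i_inj].
- by move=> _ [t _ <-]; apply/iV; exists t.
- by apply/iV; exists z.
Qed.

Lemma simple_fg S : simple_mod S -> finitely_generated S.
Proof.
move=> /simple_modP[[x x0] h]; have [x0'|xT] := h _ (is_submod1 x).
  by case: x0; apply: x0'; exists 1; rewrite scale1r.
exists 1, (fun=> x) => y; have [a ->] := xT y.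
by exists (fun=> a); rewrite big_ord1.
Qed.

Lemma simple_hom_inj S M (f : {linear S -> M}) :
  simple_mod S -> (forall x, f x = 0) \/ injective f.
Proof.
move=> /simple_modP[_ h]; have [f0|fT] := h _ (is_submod_ker f); [right|by left].
exact: linear_inj.
Qed.

Lemma simple_hom_surj M S (f : {linear M -> S}) :
  simple_mod S -> (forall x, f x = 0) \/ surjective f.
Proof.
move=> /simple_modP[_ h]; have [f0|fT] := h _ (is_submod_im f (is_submodT M)).
  by left=> x; apply: f0; exists x.
by right=> y; have [x _ <-] := fT y; exists x.
Qed.

Lemma simple_hom_isom S S' (f : {linear S -> S'}) : simple_mod S -> simple_mod S' ->
  (exists x, f x <> 0) -> isomorphic S S'.
Proof.
move=> Ss S's [x fx]; have [f0|f_inj] := simple_hom_inj f Ss; first by case: fx.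
have [f0|f_surj] := simple_hom_surj f S's; first by case: fx.
exact: isomorphic_of_bij f_inj f_surj.
Qed.

Lemma simple_mod_isom S S' : isomorphic S S' -> simple_mod S -> simple_mod S'.
Proof.
move=> [f [g fK gK]] /simple_modP[[x x0] h]; apply/simple_modP; split.
  by exists (f x) => fx; apply: x0; rewrite -[x]fK fx -(linear0 f) fK.
move=> V Vs; have [V0|VT] := h _ (is_submod_preim f Vs).
  by left=> y Vy; rewrite -[y]gK (V0 (g y)) ?linear0 // gK.
by right=> y; rewrite -[y]gK.
Qed.

Lemma soc_inclusion M : exists i : {linear soc M -> M},
  injective i /\ forall x, x \in @socle R M <-> exists y, i y = x.
Proof.
exists (\val : {linear soc M -> M}); split; first exact: val_inj.
by move=> x; split=> [xs|[y <-]]; [exists (exist _ x xs) | exact: valP].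
Qed.

Lemma simple_in_socle S M (i : {linear S -> M}) x :
  simple_mod S -> injective i -> i x \in @socle R M.
Proof.
move=> Ss i_inj.
have [V VE] := submodClosed_of (is_submod_im i (is_submodT S)).
apply/asboolP; exists 1, (fun=> V), (fun=> i x); split=> [_|_|].
- apply: simple_mod_isom Ss.
  have [j jE] := @factor_inj _ S (submod V) M (\val : {linear submod V -> M}) i val_inj
    (fun s => ex_intro _ (exist _ (i s) ((VE _).2 (ex_intro2 _ _ s I erefl))) erefl).
  apply: (isomorphic_of_bij (f := j)); first by move=> y z e; apply: i_inj; rewrite -!jE e.
  move=> y; have [s _ sE] := (VE (\val y)).1 (valP y).
  by exists s; apply: val_inj; rewrite -sE -jE.
- by apply/VE; exists x.
by rewrite big_ord1.
Qed.

Lemma inj_of_inj_socle M N (f : {linear M -> N}) : ranked M ->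
  (forall x, x \in @socle R M -> f x = 0 -> x = 0) -> injective f.
Proof.
move=> rM fs; apply: linear_inj => x fx; apply: contrapT => x0.
have [|S [i [i_inj Ss fi]]] := simple_sub_exists rM (is_submod_ker f); first by exists x.
have /simple_modP[[y y0] _] := Ss.
by apply: y0; apply: (i_inj); rewrite linear0; apply: fs (simple_in_socle y Ss i_inj) (fi y).
Qed.

Lemma essentialP M N (f : M -> N) : essential f <->
  forall V : N -> Prop, is_submod V -> (forall x, V (f x) -> f x = 0) ->
    forall y, V y -> y = 0.
Proof.
split=> h V; last by apply: (h _ (is_submod_mem V)).
move=> /submodClosed_of[W WV] Vf y /WV; apply: h => x /WV.
exact: Vf.
Qed.

(** Every simple submodule of [N] meets the image of [S] by essentiality, hence lies in it. *)
Lemma essential_soc S N (i : {linear S -> N}) : simple_mod S -> injective i ->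
  essential i -> isomorphic S (soc N).
Proof.
move=> Ss i_inj /essentialP iess; have [v [v_inj vE]] := soc_inclusion N.
have [j jE] := @factor_inj _ _ _ _ v i v_inj (fun s => (vE _).1 (simple_in_socle s Ss i_inj)).
apply: (isomorphic_of_bij (f := j)); first by move=> y z e; apply: i_inj; rewrite -!jE e.
pose U x := exists2 s, True & i s = x.
have Us : is_submod U := is_submod_im i (is_submodT S).
suff soci x : x \in @socle R N -> U x.
  move=> y; have [s _ sE] := soci _ ((vE (v y)).2 (ex_intro _ y erefl)).
  by exists s; apply: v_inj; rewrite jE sE.
move=> /asboolP[m [T [t [Ts tT ->]]]].
refine (@is_submod_sum _ _ U _ _ _ _ Us _) => l _.
have [T0|/existsNP[s /not_implyP[Ts' s0]]] := pselect (forall s, i s \in T l -> i s = 0).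
  by exists 0; rewrite // linear0 (iess _ (is_submod_mem (T l)) T0 _ (tT l)).
have /simple_modP[_ h] := Ts l.
have [h0|hT] := h _ (is_submod_preim (\val : {linear submod (T l) -> N}) Us).
  have e : exist _ (i s) Ts' = 0 :> submod (T l) by apply: h0; exists s.
  by case: s0; apply: (congr1 val e).
exact: (hT (exist _ (t l) (tT l))).
Qed.

Lemma essential_inj M N X (i : {linear M -> N}) (f : {linear N -> X}) :
  essential i -> injective (f \o i) -> injective f.
Proof.
move=> /essentialP iess fi_inj; apply: linear_inj => y fy.
apply: iess (is_submod_ker f) _ y fy => x fix0.
by rewrite (_ : x = 0) ?linear0 //; apply: fi_inj; rewrite /= fix0 !linear0.
Qed.

Lemma essential_comp M N P (i : {linear M -> N}) (j : {linear N -> P}) :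
  injective j -> essential i -> essential j -> essential (j \o i).
Proof.
move=> j_inj /essentialP iess /essentialP jess; apply/essentialP => V Vs Vji.
apply: jess => // x Vjx; have -> : x = 0; last by rewrite linear0.
apply: iess (is_submod_preim j Vs) _ x Vjx => y /Vji jiy.
by apply: j_inj; rewrite linear0.
Qed.

(** Divide by a submodule maximal among those meeting [N] trivially. *)
Lemma essential_quotient N X (i : {linear N -> X}) : injective i -> ranked X ->
  exists Q (p : {linear X -> Q}),
    [/\ surjective p, injective (p \o i) & essential (p \o i)].
Proof.
move=> i_inj rX.
have [|V [Vs Vi Vmax]] := @ranked_max _ X (fun V => forall x, V (i x) -> x = 0) _ rX (is_submod0 X).
  by move=> x ix; apply: i_inj; rewrite ix linear0.
have [Q [p [p_surj pV]]] := quotient_exists Vs.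
exists Q, p; split=> //; first by apply: linear_inj => x /pV/Vi.
apply/essentialP => W Ws Wi y Wy; have [x xy] := p_surj y; rewrite -xy.
apply/pV/(Vmax _ (is_submod_preim p Ws)); last by rewrite xy.
  by move=> z /Wi/pV/Vi.
by move=> z /pV ->; case: Ws.
Qed.

Lemma ranked_fg_noetherian : (forall M, finitely_generated M -> ranked M) -> noetherian_mods R.
Proof. by move=> rk M N i i_inj /rk rN; apply: fg_ranked (ranked_inj i_inj rN). Qed.

(** Let [U] be a maximal essential extension of [M] in [F], and [Q] a quotient of [F] in which [U]
    is essential. The inclusion of [U] extends to an embedding Q -> F whose image is essential over
    [M], hence equals [U]. So [U] is a retract of [F]. *)
Lemma proj_inj_essential M F (f : {linear M -> F}) : ranked F ->
  injective f -> proj_inj F ->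
  exists E (e : {linear M -> E}), [/\ injective e, essential e & proj_inj E].
Proof.
move=> rF f_inj [Fp Finj].
pose T (U : F -> Prop) := (forall x, U (f x)) /\ forall V, is_submod V ->
  (forall y, V y -> U y) -> (forall x, V (f x) -> f x = 0) -> forall y, V y -> y = 0.
have [|U [Us [Uf Uess] Umax]] := @ranked_max _ F T _ rF (is_submod_im f (is_submodT M)).
  split=> [x|V Vs VU V0 y Vy]; first by exists x.
  by have [x _ e] := VU y Vy; rewrite -e; apply: V0; rewrite e.
have [E [j [j_inj jU]]] := submodule_exists Us.
have [e eE] := @factor_inj _ _ _ _ j f j_inj (fun x => (jU _).1 (Uf x)).
have [Q [p [p_surj pj_inj pjess]]] := essential_quotient j_inj rF.
have fF := Fp.1.
have fE := fg_ranked (ranked_inj j_inj rF).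
have [r rE] := Finj.2 _ _ (p \o j) j fE (fg_surj p_surj fF) pj_inj.
have r_inj : injective r.
  apply: essential_inj pjess _ => x y /=.
  by rewrite (rE x : r (p (j x)) = j x) (rE y : r (p (j y)) = j y) => /j_inj.
have /essentialP pjess' := pjess.
have rU y : U (r y).
  apply: (Umax _ (is_submod_im r (is_submodT Q))); last by exists y.
    split=> [x|V Vs Vr V0 z Vz]; first by exists (p (f x)); rewrite // -eE rE.
    have VU0 : forall y, V y /\ U y -> y = 0.
      by apply: Uess; [exact: is_submodI|move=> ? []|move=> x [/V0]].
    have [t _ tz] := Vr z Vz; suff t0 : t = 0 by rewrite -tz t0 linear0.
    apply: (pjess' _ (is_submod_preim r Vs)); last by rewrite tz.
    move=> x Vx; have jx0 : j x = 0.
      by apply: VU0; split; [rewrite -(rE x) | apply/jU; exists x].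
    by rewrite /= jx0 linear0.
  by move=> z /jU[x <-]; exists (p (j x)); rewrite ?(rE x).
have [rho rhoE] := @factor_inj _ _ _ _ j (r \o p) j_inj (fun x => (jU _).1 (rU _)).
have rhoj x : rho (j x) = x by apply: j_inj; rewrite rhoE /= rE.
exists E, e; split.
- by move=> x y xy; apply: f_inj; rewrite -!eE xy.
- apply/essentialP => V Vs V0 y Vy; apply: (j_inj); rewrite linear0.
  apply: (Uess _ (is_submod_im j Vs)); last by exists y.
    by move=> _ [z _ <-]; apply/jU; exists z.
  move=> x [z Vz zE]; rewrite -eE V0 ?linear0 //.
  by rewrite (_ : e x = z) //; apply: (j_inj); rewrite eE.
- by split; [apply: projective_retract rhoj Fp | apply: injective_retract rhoj Finj].
Qed.

Lemma linear_iter M (w : {linear M -> M}) n :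
  exists f : {linear M -> M}, forall x, f x = iter n w x.
Proof.
elim: n => [|n [f fE]]; first by exists idfun.
by exists (w \o f) => x /=; rewrite fE.
Qed.

Lemma fitting P (w : {linear P -> P}) : ranked P -> indecomposable P ->
  (exists n, forall x, iter n w x = 0) \/ (injective w /\ surjective w).
Proof.
move=> rP [Pnz Pind].
have [W WE] := choice (linear_iter w).
have imT : is_submod (fun y => exists2 x, True & W 0 x = y) by apply: is_submod_im.
have [_ [_ [m ->] mmin]] := @ranked_min _ P
  (fun U => exists m, U = fun y => exists2 x, True & W m x = y) _ rP imT (ex_intro _ 0 erefl).
have [_ [_ [l ->] lmax]] := @ranked_max _ P
  (fun U => exists l, U = fun y => W l y = 0) _ rP (is_submod_ker (W 0)) (ex_intro _ 0 erefl).
have imP n x : exists y, W m x = W (m + n) y.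
  have [||y _ yE] := mmin _ (is_submod_im (W (m + n)) (is_submodT P)) (ex_intro _ _ erefl) _ (W m x).
  - move=> _ [y _ <-]; exists (iter n w y) => //.
    by rewrite !WE iterD.
  - by exists x.
  by exists y.
have kerP n x : W (n + l) x = 0 -> W l x = 0.
  apply: (lmax _ (is_submod_ker (W (n + l))) (ex_intro _ _ erefl)) => y yl.
  by rewrite WE iterD -WE -[iter l w y]WE yl linear0.
(* Images are stable from [m] on and kernels from [l] on, so [P] is the direct sum of the image and
   kernel of w^N. The extra 1 makes [N] positive, so that ker w lies in ker w^N and im w^N in im
   w. *)
pose N := (m + l.+1)%N.
have NN x : exists y, W N x = W N (W N y).
  have [y yE] := imP N x; exists y.
  by rewrite !WE -iterD {1}/N addnC iterD -(WE m) yE WE -iterD addnA [(_ + m)%N]addnC.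
have WN0 x : W N (W N x) = 0 -> W N x = 0.
  have -> : W N (W N x) = W (N + m.+1 + l)%N x.
    by rewrite !WE -iterD -addnA addSnnS.
  by move=> /kerP Wl; rewrite WE /N addnS -addSn iterD -(WE l) Wl -WE linear0.
have [V VE] := submodClosed_of (is_submod_im (W N) (is_submodT P)).
have [K KE] := submodClosed_of (is_submod_ker (W N)).
have dec x : exists y, W N (x - W N y) = 0.
  by have [y yE] := NN x; exists y; rewrite linearB yE subrr.
have [||V0|K0] := Pind V K.
- move=> x; have [y yE] := dec x; exists (W N y), (x - W N y); split.
  + by apply/VE; exists y.
  + by apply/KE.
  + by rewrite addrC subrK.
- by move=> _ /VE[x _ <-] /KE; apply: WN0.
- by left; exists N => x; rewrite -WE; apply: V0; apply/VE; exists x.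
right; split.
  apply: linear_inj => x wx; apply: K0; apply/KE.
  by rewrite WE /N addnS iterSr wx -WE linear0.
move=> x; have [y yE] := dec x; exists (W (m + l) y).
have /eqP := K0 _ ((KE _).2 yE); rewrite subr_eq0 => /eqP ->.
by rewrite !WE -iterS -addnS.
Qed.

(** By Fitting the non-nilpotent [v \o u] is bijective, so [u] embeds [P] as a nonzero summand of
    the indecomposable [Q]. *)
Lemma indecomposable_factor P Q (u : {linear P -> Q}) (v : {linear Q -> P}) :
  ranked P -> indecomposable P -> indecomposable Q ->
  (forall n, exists x, iter n (v \o u) x <> 0) -> isomorphic P Q.
Proof.
move=> rP Pi [Qnz Qi] nn.
have [[n n0]|[vu_inj vu_surj]] := fitting (v \o u) rP Pi.
  by have [x] := nn n; rewrite n0.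
have u_inj : injective u by move=> x y e; apply: vu_inj; rewrite /= e.
have [V VE] := submodClosed_of (is_submod_im u (is_submodT P)).
have [K KE] := submodClosed_of (is_submod_ker v).
apply: (isomorphic_of_bij u_inj) => y.
have [||V0|K0] := Qi V K.
- move=> x; have [z /= zE] := vu_surj (v x); exists (u z), (x - u z); split.
  + by apply/VE; exists z.
  + by apply/KE; rewrite linearB zE subrr.
  + by rewrite addrC subrK.
- move=> _ /VE[z _ <-] /KE vuz; rewrite (_ : z = 0) ?linear0 //.
  by apply: vu_inj; rewrite /= vuz !linear0.
- have [x] := nn 1%N; case=> /=; rewrite (V0 (u x)) ?linear0 //.
  by apply/VE; exists x.
have [z /= zE] := vu_surj (v y); exists z.
apply/eqP; rewrite -subr_eq0; apply/eqP/K0/KE.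
by rewrite linearB zE subrr.
Qed.

Lemma iter_id_on M N (w : M -> M) (f : M -> N) n : (forall x, f (w x) = f x) ->
  forall x, f (iter n w x) = f x.
Proof. by move=> fw x; elim: n => //= n IH; rewrite fw. Qed.

(** If [f] does not factor through [f'], it maps ker f' onto [S], and projectivity gives an
    endomorphism w of [P] with image in ker f' and f w = f. Such a w is neither nilpotent nor onto,
    against Fitting. *)
Lemma proj_indec_top P S S' (f : {linear P -> S}) (f' : {linear P -> S'}) :
  ranked P -> projective_mod P -> indecomposable P -> simple_mod S -> simple_mod S' ->
  surjective f -> surjective f' -> isomorphic S S'.
Proof.
move=> rP [fP Pl] Pi Ss S's f_surj f'_surj.
have /simple_modP[[s s0] _] := Ss.
have [K [k kf']] := ses_ker f'_surj.
have [fk0|fk_surj] := simple_hom_surj (f \o k) Ss.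
  have [h hE] := ses_desc kf' fk0.
  apply/isomorphic_sym/(@simple_hom_isom _ _ h) => //.
  by have [x xs] := f_surj s; exists (f' x); rewrite hE xs.
have fK := fg_ranked (ranked_inj (let: And3 h _ _ := kf' in h) rP).
have [h hE] := Pl _ _ (f \o k) f fK (simple_fg Ss) fk_surj.
have [[n n0]|[_ w_surj]] := fitting (k \o h) rP Pi.
  have [x xs] := f_surj s; case: s0.
  by rewrite -xs -(@iter_id_on P S (k \o h) f n hE) n0 linear0.
have /simple_modP[[s' s'0] _] := S's; case: s'0.
have [x <-] := f'_surj s'; have [y <-] := w_surj x.
exact: ses0 kf' _.
Qed.

End Simple.

(** * From the subcategories to the coresolution *)

Section Coresolution.
Variable R : pzRingType.
Implicit Types A B E I J K M N P X : lmodType R.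

Lemma projective_regular : projective_mod (R^o : lmodType R).
Proof.
have [r rE] := @linear_coord R 1 0.
have [i iE] := linear_to_row (fun _ : 'I_1 => idfun : {linear R^o -> R^o}).
apply: (projective_retract (i := i) (r := r)) (projective_row R 1) => x.
by rewrite rE iE.
Qed.

(** If every such extension splits, pushing out [f] along [g] and retracting onto [N] extends [g]
    along [f]. *)
Lemma not_injective_extension N : finitely_generated N -> ~ injective_mod N ->
  exists X (i : {linear N -> X}), [/\ finitely_generated X, injective i &
    forall r : {linear X -> N}, exists x, r (i x) <> x].
Proof.
move=> fN nN; apply: contrapT => noX; apply: nN; split=> // A B f g fA fB f_inj.
have [t tE] := linear_pair g (\- f : {linear A -> B}).
have [X [p [p_surj pK]]] := quotient_exists (is_submod_im t (is_submodT A)).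
have [a aE] := linear_pair (idfun : {linear N -> N}) (\0 : {linear N -> B}).
have [b bE] := linear_pair (\0 : {linear B -> N}) (idfun : {linear B -> B}).
have i_inj : injective (p \o a).
  apply: linear_inj => y /pK[x _]; rewrite tE aE => -[<- /eqP]; rewrite oppr_eq0 => /eqP fx.
  by rewrite (_ : x = 0) ?linear0 //; apply: f_inj; rewrite fx linear0.
have [r rE] : exists r : {linear X -> N}, forall x, r (p (a x)) = x.
  apply: contrapT => nr; apply: noX; exists X, (p \o a); split=> //.
    exact: fg_surj p_surj (fg_prod fN fB).
  move=> r; apply/existsNP => r0.
  by apply: nr; exists r.
exists (r \o (p \o b)) => x /=; rewrite -[RHS]rE; congr (r _).
apply/eqP; rewrite -subr_eq0 -linearB; apply/eqP/pK; exists (- x) => //.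
by rewrite tE aE bE !linearN /= opprK; congr (_, _); rewrite ?sub0r ?subr0.
Qed.

Definition proj_inj_coresolved (d : nat) M : Prop :=
  exists C : injective_coresolution M,
    [/\ minimal_coresolution C,
        forall j, (j < d)%N -> projective_mod (cores_term C j) &
        forall j, (d < j)%N -> zero_mod (cores_term C j)].

Lemma essential_surj M N (f : {linear M -> N}) : surjective f -> essential f.
Proof.
move=> f_surj V Vf y Vy; have [x xy] := f_surj y.
by rewrite -xy Vf // xy.
Qed.

Lemma proj_inj_coresolved0 M : injective_mod M -> proj_inj_coresolved 0 M.
Proof.
move=> Minj.
pose T j := if j is 0 then M else 'rV[R]_0.
pose d j : {linear T j -> T j.+1} := \0.
have Tinj j : injective_mod (T j).
  by case: j => [|j] //; apply: injective_zero (@zero_row0 R).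
have ex0 : exact (idfun : {linear M -> T 0}) (d 0).
  by move=> y; split=> // _; exists y.
have ex j : exact (d j) (d j.+1).
  by move=> y; split=> // _; exists 0; rewrite [RHS]zero_row0.
exists (@InjectiveCoresolution R M T idfun d Tinj (@inj_id M) ex0 ex); split=> //.
- split=> [|j] /=; apply: essential_surj => y; first by exists y.
  by exists 0; rewrite [RHS]zero_row0.
- by case=> // j _; apply: zero_row0.
Qed.

Lemma proj_inj_coresolvedS d M E N (i : {linear M -> E}) (p : {linear E -> N}) :
  ses i p -> essential i -> proj_inj E -> proj_inj_coresolved d N ->
  proj_inj_coresolved d.+1 M.
Proof.
move=> ip iess [Ep Einj] [C [[augess dess] Cp C0]].
have [i_inj p_surj ipex] := ip.
pose T j := if j is j'.+1 then cores_term C j' else E.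
pose dd j : {linear T j -> T j.+1} := match j return {linear T j -> T j.+1} with
  | 0 => cores_aug C \o p | j'.+1 => cores_diff C j' end.
have Tinj j : injective_mod (T j) by case: j => [|j] //; apply: cores_injective.
have ex0 : exact (i : {linear M -> T 0}) (dd 0).
  move=> y; rewrite -(ipex y) /=; split=> [h|->]; last exact: linear0.
  by apply: (@cores_aug_inj _ _ C); rewrite h linear0.
have ex j : exact (dd j) (dd j.+1).
  case: j => [|j]; last exact: cores_exact.
  move=> y; rewrite (@cores_exact0 _ _ C y); split=> [[x <-]|[x <-]]; last by exists (p x).
  by have [z <-] := p_surj x; exists z.
exists (@InjectiveCoresolution R M T i dd Tinj i_inj ex0 ex); split=> //=.
- split=> // -[|j] /=; last exact: dess.
  apply/essentialP => V Vs Vp; move/essentialP: augess => h.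
  by apply: h Vs _ => y; have [x <-] := p_surj y; apply: Vp.
- by case.
- by case=> // j; apply: C0.
Qed.

End Coresolution.

(** * Projective-injective coresolutions from the equality of the subcategories *)

Section Backward.
Variables (L : pzRingType) (n : nat).
Hypothesis rk : forall M : lmodType L, finitely_generated M -> ranked M.
Hypothesis GP_soc : forall N : lmodType L, GP_le n N <-> socGP_le n N.
Hypothesis soc_sub : forall N : lmodType L, socGP_le n N <-> sub_regular N.
Implicit Types A B E F I J K M N P Q S X : lmodType L.

Let noeth : noetherian_mods L := ranked_fg_noetherian rk.

(** The socle of [N] is [S], so the hypotheses put [N] in [sub L]; a coordinate that is nonzero on
    [S] is injective on [S], hence on [N]. *)
Lemma essential_embeds_regular S N (i : {linear S -> N}) :
  simple_mod S -> cogenerated_by_regular S -> finitely_generated N ->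
  injective i -> essential i -> exists c : {linear N -> L^o}, injective c.
Proof.
move=> Ss Ssub fN i_inj iess.
have /soc_sub/GP_soc[_ SG] : sub_regular S by split=> //; apply: simple_fg.
have : socGP_le n N by split=> //; apply: Gpd_le_isom SG; apply: essential_soc iess.
move=> /soc_sub[_ [k [f f_inj]]].
have /simple_modP[[x x0] _] := Ss.
have [l lx] : exists l, f (i x) 0 l <> 0.
  apply: contrapT => h; apply: x0; apply: i_inj; apply: f_inj; rewrite !linear0.
  apply/rowP => l; rewrite !mxE; apply: contrapT => hl.
  by apply: h; exists l.
have [c cE] := linear_coord L l.
exists (c \o f); apply: essential_inj iess _.
have [c0|//] := simple_hom_inj ((c \o f) \o i) Ss.
by case: lx; rewrite -cE; apply: c0.
Qed.

(** Without an injective essential extension, [S] would have essential extensions whose images in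
    [L] have unbounded rank. An injective one embeds in [L], so it is a summand and projective. *)
Lemma simple_proj_inj_hull S : simple_mod S -> cogenerated_by_regular S ->
  exists J (i : {linear S -> J}), injective i /\ proj_inj J.
Proof.
move=> Ss Ssub.
suff [J [i [fJ i_inj iess Jinj]]] : exists J (i : {linear S -> J}),
    [/\ finitely_generated J, injective i, essential i & injective_mod J].
  have [c c_inj] := essential_embeds_regular Ss Ssub fJ i_inj iess.
  exists J, i; split=> //; split=> //.
  have [r rE] := Jinj.2 _ _ c idfun fJ (projective_regular L).1 c_inj.
  exact: projective_retract rE (projective_regular L).
apply: contrapT => noJ.
have [r rP] := rk (projective_regular L).1.
pose im N (c : {linear N -> L^o}) : L^o -> Prop := fun y => exists2 x, True & c x = y.
have ims N (c : {linear N -> L^o}) : is_submod (im N c) by apply: is_submod_im.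
have grow m : exists N (i : {linear S -> N}), [/\ finitely_generated N, injective i,
    essential i & forall c : {linear N -> L^o}, injective c -> (m <= r (im N c))%N].
  elim: m => [|m [N [i [fN i_inj iess ir]]]].
    exists S, idfun; split=> //; first exact: simple_fg.
    by apply: essential_surj => x; exists x.
  have [|X [e [fX e_inj ne]]] := not_injective_extension fN.
    by move=> Ninj; apply: noJ; exists N, i.
  have [Q [p [p_surj pe_inj pe_ess]]] := essential_quotient e_inj (rk fX).
  exists Q, ((p \o e) \o i); split.
  - exact: fg_surj p_surj fX.
  - exact: inj_comp.
  - exact: essential_comp.
  move=> c c_inj; have ce_inj : injective (c \o (p \o e)) by apply: inj_comp.
  apply: leq_ltn_trans (ir _ ce_inj) _.
  have [||le ge] := rP _ _ (ims _ (c \o (p \o e))) (ims _ c).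
  - by move=> _ [x _ <-]; exists (p (e x)).
  - by [].
  rewrite ltnNge; apply/negP => /ge h.
  have pe_surj : surjective (p \o e).
    move=> y; have [|x _ xE] := h (c y); first by exists y.
    by exists x; apply: c_inj.
  have [s sE] := factor_inj pe_inj (fun x => pe_surj (p x)).
  by have [x] := ne s; apply; apply: pe_inj; rewrite sE.
have [N [i [fN i_inj iess ir]]] := grow (r (fun=> True)).+1.
have [c c_inj] := essential_embeds_regular Ss Ssub fN i_inj iess.
have [//|//|h _] := rP _ (fun=> True) (ims _ c) (is_submodT _) _ _.
by have := leq_trans (ir c c_inj) h; rewrite ltnn.
Qed.

(** Take a map to a projective-injective with minimal kernel; a simple in that kernel could be
    detected by adding a summand [J]. *)
Lemma sub_embeds_proj_inj M : finitely_generated M -> cogenerated_by_regular M ->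
  exists F (f : {linear M -> F}), injective f /\ proj_inj F.
Proof.
move=> fM Msub; have rM := rk fM.
pose T (U : M -> Prop) := exists F (f : {linear M -> F}), proj_inj F /\ U = fun x => f x = 0.
have T0 : T (fun x => (\0 : {linear M -> 'rV[L]_0}) x = 0).
  exists 'rV[L]_0, \0; split=> //; split; first exact: projective_zero (@zero_row0 L).
  exact: injective_zero (@zero_row0 L).
have [_ [_ [F [f [[Fp Finj] ->]]] Umin]] := ranked_min rM (is_submod_ker _) T0.
exists F, f; split=> //; apply: linear_inj => x fx; apply: contrapT => x0.
have [|S [i [i_inj Ss fi]]] := simple_sub_exists rM (is_submod_ker f); first by exists x.
have [J [e [e_inj [Jp Jinj]]]] := simple_proj_inj_hull Ss (torsionless_sub i_inj Msub).
have [h hE] := Jinj.2 _ _ i e (simple_fg Ss) fM i_inj.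
have [g gE] := linear_pair f h.
have fg0 : forall y, f y = 0 -> g y = 0.
  apply: Umin (is_submod_ker g) _ _.
    exists (F * J)%type, g; split=> //; split; first exact: projective_prod.
    exact: injective_prod.
  by move=> y; rewrite gE => -[].
have /simple_modP[[y y0] _] := Ss.
apply: y0; apply: e_inj; rewrite linear0 -hE.
by have := fg0 _ (fi y); rewrite gE => -[].
Qed.

Lemma sub_essential_proj_inj M : finitely_generated M -> cogenerated_by_regular M ->
  exists E (e : {linear M -> E}), [/\ injective e, essential e & proj_inj E].
Proof.
move=> fM /(sub_embeds_proj_inj fM)[F [f [f_inj PF]]].
exact: proj_inj_essential (rk PF.1.1) f_inj PF.
Qed.

Lemma gp_dim_sub N j : (j <= n)%N -> gp_dim_le j N -> cogenerated_by_regular N.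
Proof.
move=> jn Nj; have /GP_soc/soc_sub[] // : GP_le n N.
by split; [apply: gp_dim_le_fg Nj | apply/Gpd_leP; exists j].
Qed.

Definition ext1_gp_zero (j : nat) N : Prop :=
  forall m X, (m <= j)%N -> gp_dim_le m X -> ext1_zero X N.

Lemma ext1_gp_zero_regular : ext1_gp_zero 0 L^o.
Proof.
move=> [|//] X _ /gorenstein_projective_ker[K [P [k [q [kq Pp _ h]]]]].
exact: ext1_zero_of_presentation Pp kq h.
Qed.

(** Both cases are dimension shifts: syzygies of Gorenstein projectives are Gorenstein projective,
    and other syzygies drop one in [gp_dim_le]. *)
Lemma ext1_gp_zeroS j N E N' (i : {linear N -> E}) (p : {linear E -> N'}) :
  ses i p -> injective_mod E -> ext1_gp_zero j N -> ext1_gp_zero j.+1 N'.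
Proof.
move=> ip Einj Nj; have GN' X : gorenstein_projective X -> ext1_zero X N'.
  move=> /gorenstein_projective_ker[K [P [k [q [kq Pp KG _]]]]].
  have KN : ext1_zero K N by apply: (Nj 0).
  exact (ext1_zero_shift noeth kq ip Pp.1 Einj KN (ext1_zero_proj (N := N') Pp)).
move=> [|m] X mj; first exact: GN'.
move=> [K [G [k [q [kq GG Km]]]]].
have fG := gorenstein_projective_fg GG.
exact (ext1_zero_shift noeth kq ip fG Einj (Nj m K mj Km) (GN' _ GG)).
Qed.

(** [N] plays the role of the [j]-th cosyzygy of [L], with [d] terms still to be shown
    projective. *)
Lemma gp_dim_coresolved d j N : (d + j = n.+1)%N -> gp_dim_le j N -> ext1_gp_zero j N ->
  proj_inj_coresolved d N.
Proof.
elim: d j N => [|d IH] j N dj Nj Next.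
  (* Now j = n + 1. The first syzygy of any [X] lies in [sub L], hence has Gpd at most n, so [X] has
     Gpd at most n + 1 and Ext^1(X, N) = 0. *)
  apply: proj_inj_coresolved0; apply: injective_of_ext1; first exact: gp_dim_le_fg Nj.
  move=> X /free_cover[m [K [k [q kq]]]].
  have fK := ses_fgl noeth kq (fg_row L m).
  have /soc_sub/GP_soc[_ /Gpd_leP[l ln Kl]] : sub_regular K.
    by split=> //; exists m, k; case: kq.
  apply: (Next l.+1); first by rewrite -[j]add0n dj.
  exists K, 'rV[L]_m, k, q; split=> //.
  exact: gorenstein_projective_proj (projective_row L m).
have jn : (j <= n)%N by move: dj; rewrite addSn => -[<-]; apply: leq_addl.
have fN := gp_dim_le_fg Nj.
have [E [e [e_inj eess [Ep Einj]]]] := sub_essential_proj_inj fN (gp_dim_sub jn Nj).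
have [N' [p ep]] := ses_coker e_inj.
apply: (proj_inj_coresolvedS ep eess) => //.
apply: IH (j.+1) _ _ _ _; first by rewrite addnS -addSn.
  by exists N, E, e, p; split=> //; apply: gorenstein_projective_proj.
exact: ext1_gp_zeroS ep Einj Next.
Qed.

Lemma minimal_auslander_gorenstein_of_sub : minimal_auslander_gorenstein n L.
Proof.
have [|||C [Cmin Cp C0]] := @gp_dim_coresolved n.+1 0 L^o.
- by rewrite addn0.
- exact: gorenstein_projective_proj (projective_regular L).
- exact: ext1_gp_zero_regular.
split; first by exists C, n.+1.
by exists C => //; exists n.+1.
Qed.

End Backward.

(** * From the coresolution to the subcategories *)

(** Cosyzygies indexed from [M] itself, so that degree 0 needs no separate treatment. *)
Definition shift_seq (R : pzRingType) (M : lmodType R) (Z : nat -> lmodType R) (j : nat) :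
  lmodType R := if j is j'.+1 then Z j' else M.

Lemma torsionless_prod (R : pzRingType) (M N : lmodType R) :
  cogenerated_by_regular M -> cogenerated_by_regular N ->
  cogenerated_by_regular (M * N)%type.
Proof.
move=> [k [f f_inj]] [l [g g_inj]].
have [c cE] := choice (fun t => @linear_coord R k t).
have [d dE] := choice (fun t => @linear_coord R l t).
have [F FE] := linear_to_row (fun t => match split t with
  | inl a => c a \o (f \o fst) | inr b => d b \o (g \o snd) end
    : {linear (M * N)%type -> R^o}).
exists (k + l)%N, F; apply: linear_inj => -[x y] Fxy.
have Ft t : F (x, y) 0 t = 0 by rewrite Fxy mxE.
congr (_, _).
  apply: f_inj; apply/rowP => a; rewrite linear0 mxE -(Ft (lshift l a)) FE.
  by rewrite (unsplitK (inl a) : split (lshift l a) = _) -[RHS]/(c a (f x)) cE.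
apply: g_inj; apply/rowP => b; rewrite linear0 mxE -(Ft (rshift k b)) FE.
by rewrite (unsplitK (inr b) : split (rshift k b) = _) -[RHS]/(d b (g y)) dE.
Qed.

Section ExtMore.
Variable R : pzRingType.
Hypothesis noeth : noetherian_mods R.
Implicit Types A B C E F I J K M N P Q S W X Y : lmodType R.

Lemma cosyzygies M (C : injective_coresolution M) :
  exists (Z : nat -> lmodType R) (i : forall j, {linear shift_seq M Z j -> cores_term C j})
    (p : forall j, {linear cores_term C j -> shift_seq M Z j.+1}), forall j, ses (i j) (p j).
Proof.
have /choice[Z ZP] (j : nat) : exists K (e : {linear K -> cores_term C j.+1}),
    injective e /\ forall y, (exists2 x, True & cores_diff C j x = y) <-> exists x, e x = y.
  exact: submodule_exists (is_submod_im _ (is_submodT _)).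
have iP (j : nat) : exists i : {linear shift_seq M Z j -> cores_term C j},
    injective i /\ exact i (cores_diff C j).
  case: j => [|j]; first by exists (cores_aug C); split; [exact: cores_aug_inj | exact: cores_exact0].
  have [e [e_inj eE]] := ZP j; exists e; split=> // y.
  by rewrite (@cores_exact _ _ C j y) -eE; split=> [[x]|[x]]; exists x.
pose i j := projT1 (cid (iP j)).
have iE j : injective (i j) /\ exact (i j) (cores_diff C j) := projT2 (cid (iP j)).
have pP (j : nat) : exists p : {linear cores_term C j -> shift_seq M Z j.+1}, ses (i j) p.
  have [i1_inj i1ex] := iE j.+1; have [i_inj iex] := iE j.
  have [p pE] := factor_inj i1_inj
    (fun x => (i1ex _).1 ((@cores_exact _ _ C j _).2 (ex_intro _ x erefl))).
  exists p; split=> // [z|y].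
    have /cores_exact[x xE] := (i1ex _).2 (ex_intro _ z erefl).
    by exists x; apply: i1_inj; rewrite pE.
  rewrite -(iex y) -pE; split=> [->|h]; first exact: linear0.
  by apply: i1_inj; rewrite h linear0.
by exists Z, i, (fun j => projT1 (cid (pP j))) => j; apply: (projT2 (cid (pP j))).
Qed.

Lemma ext_zero_retract i X N N' (a : {linear N -> N'}) (r : {linear N' -> N}) :
  (forall x, r (a x) = x) -> ext_zero i X N' -> ext_zero i X N.
Proof.
move=> ra; case: i => [|i] in X *.
  by move=> XN' f x; rewrite -[LHS]ra -[a (f x)]/((a \o f) x) XN' linear0.
elim: i X => [|i IH] X XN'; last by move=> K P j q Pp jq; apply: IH; apply: XN' jq.
move=> A B i p fB ip g; have [h hE] := XN' _ _ _ _ fB ip (a \o g).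
by exists (r \o h) => x /=; rewrite hE /= ra.
Qed.

Lemma ext_zero_row i X m : ext_zero i X R^o -> ext_zero i X 'rV[R]_m.
Proof.
case: i => [|i] in X *.
  move=> X0 f x; apply/rowP => l; have [c cE] := linear_coord R l.
  by rewrite -cE -[c (f x)]/((c \o f) x) X0 mxE.
elim: i X => [|i IH] X X0; last by move=> K P j q Pp jq; apply: IH; apply: X0 jq.
move=> A B i p fB ip g; have [c cE] := choice (fun l : 'I_m => linear_coord R l).
have [h hE] := choice (fun l => X0 _ _ _ _ fB ip (c l \o g)).
have [F FE] := linear_to_row h.
by exists F => x; apply/rowP => l; rewrite FE hE /= cE.
Qed.

Lemma ext_zero_cosyzygy (Z E : nat -> lmodType R) (i : forall j, {linear shift_seq R^o Z j -> E j})
    (p : forall j, {linear E j -> shift_seq R^o Z j.+1}) j l X :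
  (forall j, ses (i j) (p j)) -> (forall j, injective_mod (E j)) -> finitely_generated X ->
  ext_zero l.+1 X (shift_seq R^o Z j) <-> ext_zero (l + j).+1 X R^o.
Proof.
move=> ip Einj fX; elim: j l => [|j IH] l; first by rewrite addn0.
rewrite addnS -addSn -IH; split; first exact: ext_zero_shiftl (ip j) (Einj j).
exact: ext_zero_shiftr (ip j) (Einj j) fX.
Qed.

(** As the term after degree [l] vanishes, the [l]-th cosyzygy is the injective [l]-th term. *)
Lemma ext_zero_injdim n X : injdim_le R^o n -> finitely_generated X -> ext_zero n.+1 X R^o.
Proof.
move=> [C [l [ln C0]]] fX; have [Z [i [p ip]]] := cosyzygies C.
have Zinj : injective_mod (shift_seq R^o Z l).
  have [i_inj _ ex] := ip l.
  have [i1_inj _ _] := ip l.+1.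
  have i_surj : surjective (i l).
    move=> y; apply/ex; apply: i1_inj; rewrite linear0.
    exact: C0.
  have [r rE] := factor_inj i_inj (fun x : cores_term C l => i_surj (idfun x)).
  apply: (injective_retract (i := i l) (r := r)) (cores_injective C l) => x.
  by apply: i_inj; rewrite rE.
rewrite -(subnK ln); apply/(ext_zero_cosyzygy _ _ ip (cores_injective C) fX).
exact: ext_zero_inj.
Qed.

End ExtMore.

Section Forward.
Variables (L : pzRingType) (n : nat).
Hypothesis rk : forall M : lmodType L, finitely_generated M -> ranked M.
Variables (Z E : nat -> lmodType L).
Variables (io : forall j, {linear shift_seq L^o Z j -> E j}).
Variables (pi : forall j, {linear E j -> shift_seq L^o Z j.+1}).
Hypothesis iopi : forall j, ses (io j) (pi j).
Hypothesis Einj : forall j, injective_mod (E j).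
Hypothesis Eproj : forall j, (j <= n)%N -> projective_mod (E j).
Hypothesis Winj : injective_mod (shift_seq L^o Z n.+1).
Implicit Types A B C F I J K M N P Q S X Y : lmodType L.

Local Notation Zs := (shift_seq L^o Z).

Let noeth : noetherian_mods L := ranked_fg_noetherian rk.

(** * The torsion theory with torsion-free class [sub L] *)

Definition tors X : Prop :=
  finitely_generated X /\ forall (f : {linear X -> L^o}) x, f x = 0.

Lemma tors_hom X N (f : {linear X -> N}) x : tors X -> cogenerated_by_regular N -> f x = 0.
Proof.
move=> [_ X0] [k [g g_inj]]; apply: g_inj; rewrite linear0; apply/rowP => l.
have [c cE] := linear_coord L l.
by rewrite mxE -cE -[c _]/((c \o (g \o f)) x) X0.
Qed.

Lemma proj_inj_torsionless F : proj_inj F -> cogenerated_by_regular F.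
Proof. by case=> /projective_torsionless. Qed.

Lemma coresolution_proj_inj j : (j <= n)%N -> proj_inj (E j).
Proof. by split; [apply: Eproj | apply: Einj]. Qed.

(** A map X' -> L extends to X -> E_0 by injectivity, and E_0 is projective, hence in [sub L]. *)
Lemma tors_sub X X' (i : {linear X' -> X}) : injective i -> tors X -> tors X'.
Proof.
move=> i_inj tX; have [fX _] := tX; have fX' := noeth i_inj fX; split=> // f x.
have [io_inj _ _] := iopi 0; apply: io_inj; rewrite linear0.
have [h hE] := (Einj 0).2 _ _ i (io 0 \o f) fX' fX i_inj.
by rewrite -[LHS]hE (tors_hom h _ tX) //; apply/proj_inj_torsionless/coresolution_proj_inj.
Qed.

Lemma tors_surj X Y (p : {linear X -> Y}) : surjective p -> tors X -> tors Y.
Proof.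
move=> p_surj [fX X0]; split; first exact: fg_surj p_surj fX.
by move=> f y; have [x <-] := p_surj y; apply: (X0 (f \o p)).
Qed.

(** A map to [sub L] with minimal kernel: a nonzero map from the kernel to [L] would extend to N ->
    E_0 and shrink it. *)
Lemma torsion_part N : finitely_generated N ->
  exists F (f : {linear N -> F}) K (i : {linear K -> N}),
    [/\ cogenerated_by_regular F, injective i, exact i f & tors K].
Proof.
move=> fN; have rN := rk fN.
pose T (U : N -> Prop) := exists F (f : {linear N -> F}),
  cogenerated_by_regular F /\ U = fun x => f x = 0.
have T0 : T (fun x => (\0 : {linear N -> 'rV[L]_0}) x = 0).
  by exists 'rV[L]_0, \0; split=> //; exists 0, idfun.
have [_ [_ [F [f [Fsub ->]]] Umin]] := ranked_min rN (is_submod_ker _) T0.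
have [K [i [i_inj iE]]] := submodule_exists (is_submod_ker f).
exists F, f, K, i; split=> //; have fK := noeth i_inj fN; split=> // g x.
have [io_inj _ _] := iopi 0; apply: io_inj; rewrite linear0.
have [h hE] := (Einj 0).2 _ _ i (io 0 \o g) fK fN i_inj.
have [u uE] := linear_pair f h.
have fu : forall y, f y = 0 -> u y = 0.
  apply: Umin (is_submod_ker u) _ _; last by move=> y; rewrite uE => -[].
  exists (F * E 0)%type, u; split=> //; apply: torsionless_prod => //.
  exact: proj_inj_torsionless (coresolution_proj_inj (leq0n n)).
have fix0 : f (i x) = 0 by apply/iE; exists x.
by rewrite -[LHS]hE; have := fu _ fix0; rewrite uE => -[].
Qed.

Lemma sub_of_tors_free N : finitely_generated N ->
  (forall X (f : {linear X -> N}) x, tors X -> f x = 0) -> cogenerated_by_regular N.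
Proof.
move=> fN N0; have [F [f [K [i [Fsub i_inj ex tK]]]]] := torsion_part fN.
apply: torsionless_sub Fsub; apply: linear_inj => x /ex[y <-].
exact: N0.
Qed.

Lemma sub_embeds_in_proj_inj N : finitely_generated N -> cogenerated_by_regular N ->
  exists F (f : {linear N -> F}), injective f /\ proj_inj F.
Proof.
move=> fN [k [g g_inj]]; have rN := rk fN.
pose T (U : N -> Prop) := exists F (f : {linear N -> F}), proj_inj F /\ U = fun x => f x = 0.
have T0 : T (fun x => (\0 : {linear N -> 'rV[L]_0}) x = 0).
  exists 'rV[L]_0, \0; split=> //; split; first exact: projective_zero (@zero_row0 L).
  exact: injective_zero (@zero_row0 L).
have [_ [_ [F [f [[Fp Finj] ->]]] Umin]] := ranked_min rN (is_submod_ker _) T0.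
exists F, f; split=> //; apply: linear_inj => x fx; apply: g_inj; rewrite linear0.
apply/rowP => l; rewrite mxE; have [c cE] := linear_coord L l.
have [io_inj _ _] := iopi 0; apply: io_inj; rewrite linear0 -cE.
have [u uE] := linear_pair f (io 0 \o (c \o g)).
have fu : forall y, f y = 0 -> u y = 0.
  apply: Umin (is_submod_ker u) _ _; last by move=> y; rewrite uE => -[].
  have [E0p E0i] := coresolution_proj_inj (leq0n n).
  exists (F * E 0)%type, u; split=> //; split; first exact: projective_prod.
  exact: injective_prod.
by have := fu x fx; rewrite uE => -[].
Qed.

(** An embedding of the socle in a projective-injective extends to [N], and a map injective on the
    socle is injective. *)
Lemma sub_soc N : finitely_generated N ->
  cogenerated_by_regular (soc N) <-> cogenerated_by_regular N.
Proof.
move=> fN; have [i [i_inj iE]] := soc_inclusion N.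
have fS := noeth i_inj fN; split; last exact: torsionless_sub i_inj.
move=> /(sub_embeds_in_proj_inj fS)[F [f [f_inj Fpi]]].
have [h hE] := Fpi.2.2 _ _ i f fS fN i_inj.
apply: (torsionless_sub (i := h)) (proj_inj_torsionless Fpi); apply: inj_of_inj_socle (rk fN) _.
move=> x /iE[y <-]; rewrite hE => fy.
by rewrite (_ : y = 0) ?linear0 //; apply: f_inj; rewrite fy linear0.
Qed.

(* Equivalent to dominant dimension at least d, by computing Ext(X, N) in a   *)
(* minimal injective coresolution of N.                                       *)
Definition domdim_mod (d : nat) N : Prop :=
  forall X i, tors X -> (i < d)%N -> ext_zero i X N.

Lemma domdim_modW d d' N : (d <= d')%N -> domdim_mod d' N -> domdim_mod d N.
Proof. by move=> dd' N0 X i tX id; apply: N0 => //; apply: leq_trans dd'. Qed.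

Lemma domdim_mod_ker d A B C (a : {linear A -> B}) (p : {linear B -> C}) :
  ses a p -> finitely_generated B -> domdim_mod d.+1 B -> domdim_mod d C ->
  domdim_mod d.+1 A.
Proof.
move=> ap fB Bd Cd X [|i] tX id.
  move=> f x; have [a_inj _ _] := ap; apply: a_inj; rewrite linear0.
  exact: (Bd X 0 tX id (a \o f)).
exact: ext_zero_sub ap fB (Bd X i.+1 tX id) (Cd X i tX id).
Qed.

Lemma domdim_mod_coker d A B C (a : {linear A -> B}) (p : {linear B -> C}) :
  ses a p -> finitely_generated B -> domdim_mod d.+1 A -> domdim_mod d B ->
  domdim_mod d C.
Proof.
move=> ap fB Ad Bd X i tX id; have [fX _] := tX.
exact: (ext_zero_quot noeth ap fB fX (Ad X i.+1 tX id) (Bd X i tX id)).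
Qed.

Lemma domdim_mod_proj_inj d F : proj_inj F -> domdim_mod d F.
Proof.
move=> Fpi X [|i] tX _; last exact: ext_zero_inj Fpi.2.
by move=> f x; apply: tors_hom tX (proj_inj_torsionless Fpi).
Qed.

Lemma domdim_mod_cosyzygy d j : (d + j <= n.+1)%N -> domdim_mod d (Zs j).
Proof.
elim: d j => [|d IH] j dj; first by move=> X i _.
have jn : (j <= n)%N by rewrite -ltnS (leq_trans _ dj) // addSn ltnS leq_addl.
apply: (domdim_mod_ker (iopi j) (Einj j).1).
  exact/domdim_mod_proj_inj/coresolution_proj_inj.
by apply: IH; rewrite addnS -addSn.
Qed.

Lemma domdim_mod_proj P : projective_mod P -> domdim_mod n.+1 P.
Proof.
move=> /projective_summand_row[m [a [r ra]]] X i tX id.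
apply: (ext_zero_retract (a := a) (r := r) ra); apply: ext_zero_row.
by apply: (@domdim_mod_cosyzygy n.+1 0) => //; rewrite addn0.
Qed.

(** [M] embeds in a projective with Gorenstein projective cokernel, which can be repeated [d]
    times. *)
Lemma domdim_mod_gp d M : (d <= n.+1)%N -> gorenstein_projective M -> domdim_mod d M.
Proof.
elim: d M => [|d IH] M dn MG; first by move=> X i _.
have [P [C [j [q [jq Pp CG]]]]] := gorenstein_projective_coker MG.
apply: (domdim_mod_ker jq Pp.1); first exact: domdim_modW dn (domdim_mod_proj Pp).
exact: IH (ltnW dn) CG.
Qed.

Lemma domdim_mod_gp_dim m M : (m <= n)%N -> gp_dim_le m M -> domdim_mod (n.+1 - m) M.
Proof.
elim: m M => [|m IH] M mn; first exact: domdim_mod_gp.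
move=> [K [G [j [q [jq GG Km]]]]].
have mS : (n.+1 - m = (n.+1 - m.+1).+1)%N by rewrite subSS subSn // ltnW.
apply: (domdim_mod_coker jq (gorenstein_projective_fg GG)).
  by rewrite -mS; apply: IH => //; apply: ltnW.
by apply: domdim_mod_gp => //; apply: leq_subr.
Qed.

Lemma sub_of_domdim_mod d N : finitely_generated N -> domdim_mod d.+1 N ->
  cogenerated_by_regular N.
Proof. by move=> fN Nd; apply: sub_of_tors_free => // X f x tX; apply: (Nd X 0 tX). Qed.

Lemma GP_le_sub N : GP_le n N -> cogenerated_by_regular N.
Proof.
move=> [fN /Gpd_leP[l ln Nl]].
have := domdim_mod_gp_dim ln Nl; rewrite subSn //.
exact: sub_of_domdim_mod.
Qed.

(** * Endomorphisms of [L] and of its cosyzygies modulo projective-injectives *)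

Definition pi_factors A B (f : A -> B) : Prop :=
  exists Q (al : {linear A -> Q}) (be : {linear Q -> B}),
    proj_inj Q /\ forall x, f x = be (al x).

Lemma tors_pi_factors X A B (g : {linear X -> A}) (f : A -> B) x :
  tors X -> pi_factors f -> f (g x) = 0.
Proof.
move=> tX [Q [al [be [Qpi ->]]]].
by rewrite -[al _]/((al \o g) x) (tors_hom _ _ tX (proj_inj_torsionless Qpi)) linear0.
Qed.

(** A relation: [c] is induced by [u] through some chain map. The choices made affect [c] only up to
    projective-injectives, as [lift_to_pi_factors] and [lift_to_sub] show for j at most n + 1. *)
Fixpoint lift_to (u : {linear L^o -> L^o}) (j : nat) : {linear Zs j -> Zs j} -> Prop :=
  match j return {linear Zs j -> Zs j} -> Prop with
  | 0 => fun c => forall x, c x = u x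
  | j'.+1 => fun c' => exists (c : {linear Zs j' -> Zs j'}) (a : {linear E j' -> E j'}),
      [/\ lift_to u c, forall x, a (io j' x) = io j' (c x) & forall y, c' (pi j' y) = pi j' (a y)]
  end.

Lemma fg_cosyzygy j : finitely_generated (Zs j).
Proof. exact (ses_fgl noeth (iopi j) (Einj j).1). Qed.

Lemma lift_to_exists u j : exists c : {linear Zs j -> Zs j}, lift_to u c.
Proof.
elim: j => [|j [c uc]]; first by exists u.
have [io_inj _ _] := iopi j.
have [a aE] := (Einj j).2 _ _ (io j) (io j \o c) (fg_cosyzygy j) (Einj j).1 io_inj.
have [|c' c'E] := @ses_desc _ _ _ _ _ _ _ (pi j \o a) (iopi j).
  by move=> x /=; rewrite aE (ses0 (iopi j)).
by exists c', c, a.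
Qed.

(** The terms E_0, ..., E_n are projective, so endomorphisms also descend the coresolution. *)
Lemma lift_to_surj j (c : {linear Zs j -> Zs j}) : (j <= n.+1)%N -> exists u, lift_to u c.
Proof.
elim: j c => [|j IH] c jn; first by exists c.
have [io_inj pi_surj _] := iopi j.
have [fE El] := Eproj jn.
have [a aE] := El _ _ (pi j) (c \o pi j) fE (fg_cosyzygy j.+1) pi_surj.
have [|d dE] := @ses_lift _ _ _ _ _ _ _ (a \o io j) (iopi j).
  by move=> x /=; rewrite aE /= (ses0 (iopi j)) linear0.
have [u ud] := IH d (ltnW jn).
by exists u, d, a; split=> // x; rewrite ?dE ?aE.
Qed.

Lemma lift_to_comp u v j (c d : {linear Zs j -> Zs j}) :
  lift_to u c -> lift_to v d -> lift_to (u \o v) (c \o d).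
Proof.
elim: j c d => [|j IH] c' d' /=; first by move=> cu dv x /=; rewrite dv cu.
move=> [c [a [uc ac c'a]]] [d [b [vd bd d'b]]].
exists (c \o d), (a \o b); split=> [|x|y] /=; first exact: IH.
  by rewrite bd ac.
by rewrite d'b c'a.
Qed.

Lemma lift_to_sub u v j (c d : {linear Zs j -> Zs j}) :
  lift_to u c -> lift_to v d -> lift_to (u \- v) (c \- d).
Proof.
elim: j c d => [|j IH] c' d' /=; first by move=> cu dv x /=; rewrite dv cu.
move=> [c [a [uc ac c'a]]] [d [b [vd bd d'b]]].
exists (c \- d), (a \- b); split=> [|x|y] /=; first exact: IH.
  by rewrite bd ac linearB.
by rewrite d'b c'a linearB.
Qed.

(** If [c] factors through [Q], extending Q-valued [al] to E_j and subtracting leaves a map killing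
    C_j; so the next lift factors through E_j. *)
Lemma lift_to_pi_factors u j (c : {linear Zs j -> Zs j}) : (j <= n.+1)%N -> lift_to u c ->
  (forall x, u x = 0) -> pi_factors c.
Proof.
elim: j c => [|j IH] c' jn /=.
  move=> cu u0; exists 'rV[L]_0, \0, \0; split; last by move=> x; rewrite cu u0 linear0.
  by split; [apply: projective_zero (@zero_row0 L) | apply: injective_zero (@zero_row0 L)].
move=> [c [a [uc ac c'a]]] u0; have [Q [al [be [[Qp Qi] cE]]]] := IH c (ltnW jn) uc u0.
have [io_inj pi_surj _] := iopi j.
have [al' al'E] := Qi.2 _ _ (io j) al (fg_cosyzygy j) (Einj j).1 io_inj.
have [|k kE] := @ses_desc _ _ _ _ _ _ _ (a \- (io j \o (be \o al'))) (iopi j).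
  by move=> x /=; rewrite al'E ac cE subrr.
exists (E j), k, (pi j); split; first exact: coresolution_proj_inj.
move=> z; have [y <-] := pi_surj z.
by rewrite c'a kE /= linearB (ses0 (iopi j)) subr0.
Qed.

Lemma pi_factors_lift_to u j (c : {linear Zs j -> Zs j}) : (j <= n.+1)%N -> lift_to u c ->
  pi_factors c -> pi_factors u.
Proof.
elim: j c => [|j IH] c' jn /=.
  move=> cu [Q [al [be [Qpi cE]]]]; exists Q, al, be; split=> // x.
  by rewrite -cu cE.
move=> [c [a [uc ac c'a]]] [Q [al [be [[Qp Qi] c'E]]]]; apply: IH (ltnW jn) uc _.
have [io_inj pi_surj _] := iopi j.
have [h hE] := Qp.2 _ _ (pi j) be (Einj j).1 (fg_cosyzygy j.+1) pi_surj.
have [|k kE] := @ses_lift _ _ _ _ _ _ _ (a \- (h \o (al \o pi j))) (iopi j).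
  by move=> y /=; rewrite linearB hE -c'a c'E subrr.
exists (E j), (io j), k; split; first exact: coresolution_proj_inj.
move=> x; apply: io_inj.
by rewrite kE /= ac (ses0 (iopi j)) (linear0 al) (linear0 h) [RHS]subr0.
Qed.

(** If [c] kills the torsion part, it factors through a module of [sub L], which embeds in a
    projective-injective; injectivity of C_{n+1} extends the map to it. *)
Lemma not_pi_factors_tors (c : {linear Zs n.+1 -> Zs n.+1}) : ~ pi_factors c ->
  exists X (f : {linear X -> Zs n.+1}) x, tors X /\ c (f x) <> 0.
Proof.
move=> nc; apply: contrapT => ncx; apply: nc.
have fW := fg_cosyzygy n.+1.
have [F [f [K [i [Fsub i_inj ex tK]]]]] := torsion_part fW.
have ci x : c (i x) = 0.
  by apply: contrapT => cix; apply: ncx; exists K, i, x.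
have [D [d [d_inj dE]]] := submodule_exists (is_submod_im f (is_submodT _)).
have [q qE] := factor_inj d_inj (fun x => (dE (f x)).1 (ex_intro2 _ _ x I erefl)).
have q_surj : surjective q.
  move=> y; have [x _ xE] := (dE (d y)).2 (ex_intro _ y erefl).
  by exists x; apply: d_inj; rewrite qE.
have [cb cbE] : exists cb : {linear D -> Zs n.+1}, forall x, cb (q x) = c x.
  apply: factor_surj q_surj _ => x qx.
  have /ex[y <-] : f x = 0 by rewrite -qE qx linear0.
  exact: ci.
have fD := fg_surj q_surj fW.
have [Q [g [g_inj Qpi]]] := sub_embeds_in_proj_inj fD (torsionless_sub d_inj Fsub).
have [h hE] := Winj.2 _ _ g cb fD Qpi.1.1 g_inj.
by exists Q, (g \o q), h; split=> // x /=; rewrite hE cbE.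
Qed.

(** * Every torsion simple embeds in the last cosyzygy *)

Section Counting.
Variables (m : nat) (P : 'I_m -> lmodType L).
Variables (inn : forall i, {linear P i -> L^o}) (prj : forall i, {linear L^o -> P i}).
Hypothesis prj_inn : forall i x, prj i (inn i x) = x.
Hypothesis sum_inn : forall x, x = \sum_i inn i (prj i x).
Hypothesis P_ind : forall i, indecomposable (P i).
Hypothesis P_iso : forall i j, isomorphic (P i) (P j) -> i = j.

Let P_proj i : projective_mod (P i).
Proof. exact: projective_retract (@prj_inn i) (projective_regular L). Qed.

Let rP i : ranked (P i).
Proof. exact: rk (P_proj i).1. Qed.

Let e i : {linear L^o -> L^o} := inn i \o prj i.

(* S is the simple module attached to P i: the socle of P i if P i is         *)
(* injective, and otherwise a simple torsion submodule of the last cosyzygy   *)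
(* on which the lift of the projection to P i acts as the identity.           *)
Let attached i S : Prop :=
  (injective_mod (P i) /\ exists s : {linear S -> P i}, injective s) \/
  (tors S /\ exists (s : {linear S -> Zs n.+1}) (c : {linear Zs n.+1 -> Zs n.+1}),
     [/\ injective s, lift_to (e i) c & forall x, c (s x) = s x]).

Lemma attached_exists i : exists S, simple_mod S /\ attached i S.
Proof.
have [Pi_inj|Pi_ninj] := pselect (injective_mod (P i)).
  have [S [s [s_inj Ss _]]] : exists S (s : {linear S -> P i}),
      [/\ injective s, simple_mod S & forall x : S, True].
    apply: (simple_sub_exists (rP i) (is_submodT (P i))).
    have [Pnz _] := P_ind i; apply: contrapT => h; apply: Pnz => x.
    by apply: contrapT => x0; apply: h; exists x.
  by exists S; split=> //; left; split=> //; exists s.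
have [c ec] := lift_to_exists (e i) n.+1.
(* Otherwise [e i] would factor through an injective module and [P i] would be a retract of it. *)
have nc : ~ pi_factors c.
  move=> /(pi_factors_lift_to (leqnn _) ec)[Q [al [be [[_ Qi] eE]]]].
  apply: Pi_ninj; apply: (injective_retract (i := al \o inn i) (r := prj i \o be)) Qi.
  by move=> x /=; rewrite -eE /= !prj_inn.
have [X [f [x [tX cfx]]]] := not_pi_factors_tors nc.
have fW := fg_cosyzygy n.+1.
have [S [s [s_inj Ss sP]]] := simple_sub_exists (rk fW) (is_submod_im (c \o f) (is_submodT X))
  (ex_intro2 _ _ (c (f x)) (ex_intro2 _ _ x I erefl) cfx).
have [D [d [d_inj dE]]] := submodule_exists (is_submod_im (c \o f) (is_submodT X)).
have [q qE] := factor_inj d_inj (fun x => (dE ((c \o f) x)).1 (ex_intro2 _ _ x I erefl)).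
have q_surj : surjective q.
  move=> y; have [z _ zE] := (dE (d y)).2 (ex_intro _ y erefl).
  by exists z; apply: d_inj; rewrite qE.
have [t tE] := factor_inj d_inj (fun x => (dE (s x)).1 (sP x)).
have t_inj : injective t by move=> y z yz; apply: s_inj; rewrite -!tE yz.
have tS : tors S by apply: tors_sub t_inj _; apply: tors_surj q_surj tX.
exists S; split=> //; right; split=> //; exists s, c; split=> // y.
have [z _ <-] := sP y.
(* Since [e i] is idempotent, [(c \o c) \- c] lifts the zero map, so it vanishes on images of
   torsion modules: [c] is the identity on the image of [c \o f]. *)
have ecc : lift_to ((e i \o e i) \- e i) ((c \o c) \- c).
  by apply: lift_to_sub => //; apply: lift_to_comp.
have /(tors_pi_factors f z tX) /= : pi_factors ((c \o c) \- c).
  by apply: lift_to_pi_factors ecc _ => // v /=; rewrite prj_inn subrr.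
by move=> /eqP; rewrite subr_eq0 => /eqP.
Qed.

(** The isomorphism of simples extends, by injectivity of [P i] and [P j] or of C_{n+1}, to maps
    between [P i] and [P j] with non-nilpotent composite. The mixed cases fail since a torsion
    simple does not embed in [L]. *)
Lemma attached_inj i j S S' : simple_mod S -> simple_mod S' -> attached i S -> attached j S' ->
  isomorphic S S' -> i = j.
Proof.
move=> Ss S's iS jS' SS'; apply: P_iso.
have [th [th' thK th'K]] := SS'.
have [th2 th2E] : exists h : {linear S' -> S}, forall x, h x = th' x.
  by apply: linear_of => a x y; apply: (can_inj thK); rewrite linearP !th'K.
have thK2 x : th2 (th x) = x by rewrite th2E.
have /simple_modP[[x0 x00] _] := Ss.
have fS := simple_fg Ss; have fS' := simple_fg S's.
case: iS jS' => [[Pi [s s_inj]]|[tS [s [c [s_inj ec cs]]]]]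
               [[Pj [s' s'_inj]]|[tS' [s' [c' [s'_inj ec' cs']]]]].
- have [u uE] := Pj.2 _ _ s (s' \o th) fS (P_proj i).1 s_inj.
  have [v vE] := Pi.2 _ _ s' (s \o th2) fS' (P_proj j).1 s'_inj.
  apply: (indecomposable_factor (u := u) (v := v)) => // l.
  exists (s x0) => h; apply: x00; apply: s_inj; rewrite linear0 -h.
  by elim: l {h} => //= l <-; rewrite uE /= vE /= thK2.
- case: x00; apply: s_inj; rewrite linear0.
  have fi : injective (inn i) := can_inj (@prj_inn i).
  apply: fi; rewrite linear0 -[x0]thK2.
  exact: (tS'.2 (inn i \o (s \o th2)) (th x0)).
- case: x00; rewrite -[x0]thK2 (_ : th x0 = 0) ?linear0 //; apply: s'_inj; rewrite linear0.
  have fj : injective (inn j) := can_inj (@prj_inn j).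
  apply: fj; rewrite linear0.
  exact: (tS.2 (inn j \o (s' \o th)) x0).
have fW := fg_cosyzygy n.+1.
have [f fE] := Winj.2 _ _ s (s' \o th) fS fW s_inj.
have [f' f'E] := Winj.2 _ _ s' (s \o th2) fS' fW s'_inj.
have [g gf] := lift_to_surj f (leqnn _).
have [g' g'f'] := lift_to_surj f' (leqnn _).
pose u : {linear P i -> P j} := prj j \o (g \o inn i).
pose v : {linear P j -> P i} := prj i \o (g' \o inn j).
apply: (indecomposable_factor (u := u) (v := v)) => // l; apply/existsNP => vu0.
pose w : {linear L^o -> L^o} := e i \o (g' \o (e j \o (g \o e i))).
pose cw : {linear Zs n.+1 -> Zs n.+1} := c \o (f' \o (c' \o (f \o c))).
have lw : lift_to w cw by do 4!apply: lift_to_comp => //.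
(* [wl] realises the [l]-th power of [v \o u] inside [L], and its lift fixes [S]. Were that power 0,
   the lift of [wl \o e i] would factor through a projective-injective and kill the torsion module
   [S]. *)
have [wl [cwl [wlE cwlE lwl]]] : exists (wl : {linear L^o -> L^o})
      (cwl : {linear Zs n.+1 -> Zs n.+1}),
    [/\ forall x, wl (inn i x) = inn i (iter l (v \o u) x), forall x, cwl (s x) = s x
      & lift_to wl cwl].
  elim: l {vu0} => [|l [wl [cwl [wlE cwlE lwl]]]].
    by exists (e i), c; split=> // x /=; rewrite prj_inn.
  exists (w \o wl), (cw \o cwl); split=> [x|x|]; last exact: lift_to_comp.
    by rewrite /= wlE /= !prj_inn.
  by rewrite /= cwlE cs fE /= cs' f'E /= thK2 cs.
have lz : lift_to (wl \o e i) (cwl \o c) by apply: lift_to_comp.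
apply: x00; apply: s_inj; rewrite linear0 -[s x0]cwlE -[s x0]cs.
have /(tors_pi_factors s x0 tS) // : pi_factors (cwl \o c).
apply: lift_to_pi_factors lz _ => // z /=.
by rewrite wlE vu0 linear0.
Qed.

(** Sending [i] to an index whose projective covers the attached simple [T i] is injective on a
    finite set, hence onto. So every simple is isomorphic to some [T i], and a torsion one cannot be
    a submodule of [P i]. *)
Lemma simple_tors_embeds S : simple_mod S -> tors S ->
  exists c : {linear S -> Zs n.+1}, injective c.
Proof.
have top S' : simple_mod S' -> exists i (f : {linear P i -> S'}), surjective f.
  move=> S's; have /simple_modP[[x x0] _] := S's.
  have [h hE] := linear_scale x.
  have [i hi] : exists i, h (inn i (prj i 1)) <> 0.
    apply: contrapT => h0; apply: x0; rewrite -[x]scale1r -hE [1]sum_inn linear_sum big1 // => i _.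
    by apply: contrapT => hi; apply: h0; exists i.
  exists i, (h \o inn i); have [f0|//] := simple_hom_surj (h \o inn i) S's.
  by case: hi; apply: f0.
have [T TP] := choice attached_exists.
have [t tP] := choice (fun i => top (T i) (TP i).1).
have t_inj : injective t.
  move=> i j tij; have [f f_surj] := tP i; have [g g_surj] := tP j.
  rewrite tij in f f_surj.
  have ij := proj_indec_top (rP _) (P_proj _) (P_ind _) (TP i).1 (TP j).1 f_surj g_surj.
  exact: attached_inj (TP i).1 (TP j).1 (TP i).2 (TP j).2 ij.
move=> Ss tS; have [j [f f_surj]] := top S Ss.
have [ti tiK itK] := injF_bij t_inj.
have [g g_surj] := tP (ti j); rewrite itK in g g_surj.
have ST := proj_indec_top (rP _) (P_proj _) (P_ind _) Ss (TP (ti j)).1 f_surj g_surj.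
have [h [h' hK h'K]] := ST.
have /simple_modP[[x x0] _] := Ss.
case: (TP (ti j)).2 => [[_ [s s_inj]]|[_ [s [c [s_inj _ _]]]]]; last first.
  by exists (s \o h); apply: inj_comp => //; apply: can_inj hK.
case: x0; apply: (can_inj hK); apply: s_inj; apply: (can_inj (@prj_inn _)).
rewrite !linear0.
exact: (tS.2 (inn (ti j) \o (s \o h)) x).
Qed.

End Counting.

(** * Syzygies, left approximations and Gorenstein projectivity *)

Section SubGP.
Hypothesis simple_embeds : forall S, simple_mod S -> tors S ->
  exists c : {linear S -> Zs n.+1}, injective c.
Hypothesis approximation : forall K, finitely_generated K ->
  exists m (F : {linear K -> 'rV[L]_m}), forall f : {linear K -> L^o},
    exists h : {linear 'rV[L]_m -> L^o}, forall x, h (F x) = f x.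

(** A torsion simple in [Y] embeds in C_{n+1}; the embedding extends to [Y] and, as Ext^1(Y, C_n) =
    0, lifts to E_n. But E_n lies in [sub L] and receives only zero from torsion. *)
Lemma domdim_mod1_of_ext1 Y : finitely_generated Y -> ext1_zero Y (Zs n) -> domdim_mod 1 Y.
Proof.
move=> fY Yext X [|//] tX _ f x; apply: contrapT => fx.
have [D [d [d_inj dE]]] := submodule_exists (is_submod_im f (is_submodT X)).
have [q qE] := factor_inj d_inj (fun x => (dE (f x)).1 (ex_intro2 _ _ x I erefl)).
have q_surj : surjective q.
  move=> y; have [z _ zE] := (dE (d y)).2 (ex_intro _ y erefl).
  by exists z; apply: d_inj; rewrite qE.
have tD := tors_surj q_surj tX.
have [|S [s [s_inj Ss _]]] := simple_sub_exists (rk tD.1) (is_submodT D).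
  by exists (q x) => // qx; apply: fx; rewrite -qE qx linear0.
have tS := tors_sub s_inj tD.
have [c c_inj] := simple_embeds Ss tS.
have ds_inj : injective (d \o s) by apply: inj_comp.
have [h hE] := Winj.2 _ _ (d \o s) c (simple_fg Ss) fY ds_inj.
have [g gE] := ext1_zero_lift noeth h (iopi n) (Einj n).1 fY Yext.
have /simple_modP[[z z0] _] := Ss; apply: z0; apply: c_inj; rewrite linear0.
rewrite -hE -gE -[g _]/((g \o (d \o s)) z).
by rewrite (tors_hom _ _ tS (proj_inj_torsionless (coresolution_proj_inj (leqnn n)))) linear0.
Qed.

(** Pass to the cokernel of an embedding in a projective-injective: [t] drops by one and the Ext^1
    conditions move up one cosyzygy, until the previous lemma applies. *)
Lemma domdim_modS_of_ext1 t Y : (t <= n)%N -> finitely_generated Y -> domdim_mod t Y ->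
  (forall j, (n - t <= j <= n)%N -> ext1_zero Y (Zs j)) -> domdim_mod t.+1 Y.
Proof.
elim: t Y => [|t IH] Y tn fY Yt Yext.
  by apply: domdim_mod1_of_ext1 => //; apply: Yext; rewrite leqnn leq_subr.
have [F [f [f_inj Fpi]]] := sub_embeds_in_proj_inj fY (sub_of_domdim_mod fY Yt).
have [Y' [p fp]] := ses_coker f_inj; have fF := Fpi.1.1.
apply: (domdim_mod_ker fp fF); first exact: domdim_mod_proj_inj.
apply: IH (ltnW tn) (ses_fgr fp fF) _ _.
  exact (domdim_mod_coker fp fF Yt (domdim_mod_proj_inj Fpi)).
(* Index 0 is out of range because [t < n], so each remaining cosyzygy has a predecessor to shift
   from. *)
move=> [|j] /andP[tj jn].
  by move: tj; rewrite leqn0 subn_eq0 leqNgt tn.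
apply: (ext1_zero_shift noeth fp (iopi j) fF (Einj j)); last exact: ext1_zero_proj Fpi.1.
apply: Yext; rewrite (ltnW jn) andbT -ltnS (leq_trans _ tj) //.
by rewrite subnS prednK // subn_gt0.
Qed.

(* The properties shared by all t-th syzygies; for t = n + 1 they survive     *)
(* passing to the cokernel of a left approximation by free modules.           *)
Definition syzygy_like (t : nat) K : Prop :=
  [/\ finitely_generated K, domdim_mod t K &
      forall j, (n.+1 <= t + j)%N -> (j <= n.+1)%N -> ext1_zero K (Zs j)].

(** A syzygy gains one degree of dominant dimension, and its Ext^1 vanishes one cosyzygy earlier by
    dimension shifting; at n + 1 injectivity suffices. *)
Lemma syzygy_like_ker t K P M (j : {linear K -> P}) (q : {linear P -> M}) :
  ses j q -> projective_mod P -> (t <= n)%N -> syzygy_like t M -> syzygy_like t.+1 K.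
Proof.
move=> jq Pp tn [fM Mt Mext]; split.
- exact (ses_fgl noeth jq Pp.1).
- by apply: (domdim_mod_ker jq Pp.1) Mt; apply: domdim_modW (domdim_mod_proj Pp).
move=> l tl; rewrite leq_eqVlt => /orP[/eqP ->|ln]; first exact (ext1_zero_inj noeth Winj).
apply: (ext1_zero_syzygy noeth jq (iopi l) Pp (Einj l)).
by apply: Mext => //; rewrite addnS -addSn.
Qed.

Lemma syzygy_like_gp K : syzygy_like n.+1 K -> gorenstein_projective K.
Proof.
apply: gorenstein_projective_coind => {}K [fK Kn Kext].
  have [m [F FE]] := approximation fK.
  have F_inj : injective F.
    have [k [g g_inj]] := sub_of_domdim_mod fK Kn.
    apply: linear_inj => x Fx; apply: g_inj; rewrite linear0; apply/rowP => l.
    have [c cE] := linear_coord L l; have [h hE] := FE (c \o g).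
    by rewrite mxE -cE -[c _]/((c \o g) x) -hE Fx linear0.
  have [C [p Fp]] := ses_coker F_inj; have Pp := projective_row L m.
  (* For j = 0 this is the approximation property of [F]; for larger j it is shifted from [K] and
     C_{j-1}. *)
  have Cext j : (j <= n.+1)%N -> ext1_zero C (Zs j).
    case: j => [_|j jn]; first exact: ext1_zero_of_presentation Pp Fp FE.
    apply: (ext1_zero_shift noeth Fp (iopi j) Pp.1 (Einj j)).
      by apply: Kext; [apply: leq_addr | apply: ltnW].
    exact: ext1_zero_proj Pp.
  exists 'rV[L]_m, C, F, p; split=> //; split=> [||j _]; [exact: ses_fgr Fp Pp.1| |exact: Cext].
  apply: domdim_modS_of_ext1 => //; first exact: ses_fgr Fp Pp.1.
    exact: domdim_mod_coker Fp Pp.1 Kn (domdim_modW (leqnSn n) (domdim_mod_proj Pp)).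
  by move=> j /andP[_ jn]; apply: Cext; apply: leqW.
have [m [K' [j [q jq]]]] := free_cover fK; have Pp := projective_row L m.
have K0 : ext1_zero K L^o by apply: (Kext 0); rewrite ?addn0.
exists K', 'rV[L]_m, j, q; split=> //; last by move=> f; apply: (K0 _ _ _ _ Pp.1 jq).
apply: (syzygy_like_ker jq Pp (leqnn n)); split=> //; first exact: domdim_modW Kn.
by move=> l _; apply: Kext; apply: leq_addr.
Qed.

Lemma syzygy_like_gp_dim l t K : (t + l = n.+1)%N -> syzygy_like t K -> gp_dim_le l K.
Proof.
elim: l t K => [|l IH] t K; first by rewrite addn0 => -> /syzygy_like_gp.
move=> tl Kt; have [fK _ _] := Kt; have [m [K' [j [q jq]]]] := free_cover fK.
have Pp := projective_row L m.
exists K', 'rV[L]_m, j, q; split=> //; first exact: gorenstein_projective_proj.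
apply: IH (t.+1) _ _ _; first by rewrite addSn -addnS.
by apply: (syzygy_like_ker jq Pp) => //; rewrite -ltnS -tl addnS ltnS leq_addr.
Qed.

(** The cokernel of an embedding in a free module is [syzygy_like 0], as all finitely generated
    modules are; so [N] is [syzygy_like 1], with n steps left. *)
Lemma sub_GP_le N : finitely_generated N -> cogenerated_by_regular N -> GP_le n N.
Proof.
move=> fN [k [f f_inj]]; split=> //; apply/Gpd_leP; exists n => //.
apply: (@syzygy_like_gp_dim n 1) => //.
have [Y [p fp]] := ses_coker f_inj; have Pp := projective_row L k.
apply: (syzygy_like_ker fp Pp (leq0n n)); split; first exact: ses_fgr fp Pp.1.
  by move=> X i _.
move=> j nj jn; rewrite (_ : j = n.+1); first exact (ext1_zero_inj noeth Winj).
by apply/eqP; rewrite eqn_leq jn.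
Qed.

End SubGP.

End Forward.

Lemma basic_decomposition (L : pzRingType) : basic L ->
  exists m (P : 'I_m -> lmodType L) (inn : forall i, {linear P i -> L^o})
      (prj : forall i, {linear L^o -> P i}),
    [/\ forall i x, prj i (inn i x) = x, forall x, x = \sum_i inn i (prj i x),
        forall i, indecomposable (P i) & forall i j, isomorphic (P i) (P j) -> i = j].
Proof.
move=> [m [P [Pdec Pind Piso]]].
have [u uP] := choice (fun x => Pdec x).
have uU x (v : {ffun 'I_m -> L^o}) : (forall i, v i \in P i) -> x = \sum_i v i -> v = u x.
  by move=> vP xv; apply/esym; apply: (uP x).2.
have [prj prjE] : exists prj : forall i, {linear L^o -> submod (P i)},
    forall i x, \val (prj i x) = u x i.
  have prjP i : exists f : {linear L^o -> submod (P i)}, forall x, \val (f x) = u x i.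
    have [|f fE] := @linear_of L L^o L^o (fun x => u x i).
      move=> a x y.
      have <- : [ffun i => a *: u x i + u y i] = u (a *: x + y) :> {ffun 'I_m -> L^o}.
        apply: uU => [k|].
          by rewrite ffunE rpredD ?rpredZ //; case: (uP x) (uP y) => -[h _] _ [[h' _] _].
        under eq_bigr do rewrite ffunE.
        by rewrite big_split -scaler_sumr -(uP x).1.2 -(uP y).1.2.
      by rewrite ffunE.
    have [g gE] := @factor_inj _ _ _ _ (\val : {linear submod (P i) -> L^o}) f val_inj
      (fun x => ex_intro _ (exist _ (f x) (eq_rect_r (fun y => y \in P i) ((uP x).1.1 i) (fE x))) erefl).
    by exists g => x; rewrite gE fE.
  by exists (fun i => projT1 (cid (prjP i))) => i; apply: (projT2 (cid (prjP i))).
exists m, (fun i => submod (P i)), (fun i => \val : {linear submod (P i) -> L^o}), prj; split=> //.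
  move=> i x; apply: val_inj; rewrite prjE.
  rewrite -(uU (\val x) [ffun j => if j == i then \val x else 0]) ?ffunE ?eqxx //.
    by move=> j; rewrite ffunE; case: eqP => [->|_]; [exact: valP | exact: rpred0].
  rewrite (bigD1 i) //= ffunE eqxx big1 ?addr0 // => j /negbTE ji.
  by rewrite ffunE ji.
move=> x; rewrite [LHS](uP x).1.2; apply: eq_bigr => i _.
exact: esym (prjE i x).
Qed.

Theorem theorem3 (n : nat) (L : pzRingType) (n_gt0 : (0 < n)%N)
    (artinL : artin_algebra L) (basicL : basic L) :
  minimal_auslander_gorenstein n L <->
  (forall N : lmodType L, GP_le n N <-> socGP_le n N) /\
  (forall N : lmodType L, socGP_le n N <-> sub_regular N).
Proof.
have rk := artin_algebra_ranked artinL.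
have noeth := ranked_fg_noetherian rk.
split=> [[idL [C _ [d nd Cproj]]]|[]]; last exact: minimal_auslander_gorenstein_of_sub.
have [Z [io [pi iopi]]] := cosyzygies C.
have Einj := @cores_injective _ _ C.
have Eproj j : (j <= n)%N -> projective_mod (cores_term C j).
  by move=> jn; apply: Cproj; apply: leq_trans nd.
have fW : finitely_generated (shift_seq L^o Z n.+1).
  exact (ses_fgl noeth (iopi n.+1) (Einj n.+1).1).
have Winj : injective_mod (shift_seq L^o Z n.+1).
  (* Ext^1(X, C_{n+1}) is Ext^{n+2}(X, L), which vanishes because the injective dimension is at most
     n + 1. *)
  apply: injective_of_ext1 fW _ => X fX.
  apply/(@ext_zero_cosyzygy _ noeth Z _ io pi n.+1 0 X iopi Einj fX).
  exact: ext_zero_injdim.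
have [m [P [inn [prj [prj_inn sum_inn P_ind P_iso]]]]] := basic_decomposition basicL.
have embeds := simple_tors_embeds rk iopi Einj Eproj Winj prj_inn sum_inn P_ind P_iso.
have GP_sub (N : lmodType L) : GP_le n N <-> sub_regular N.
  split=> [Nn|[fN Nsub]].
    by split; [case: Nn | exact (GP_le_sub rk iopi Einj Eproj Nn)].
  exact (sub_GP_le rk iopi Einj Eproj Winj embeds (left_approximation artinL) fN Nsub).
have soc_sub (N : lmodType L) : socGP_le n N <-> sub_regular N.
  have [i [i_inj _]] := soc_inclusion N.
  split=> -[fN h]; split=> //; have fS := noeth _ _ _ i_inj fN.
    have /GP_sub[_] : GP_le n (soc N) by [].
    by move/(sub_soc rk iopi Einj Eproj fN).
  have /GP_sub[] // : sub_regular (soc N).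
  by split=> //; apply/(sub_soc rk iopi Einj Eproj fN).
by split=> // N; rewrite GP_sub soc_sub.
Qed.
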